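(* There exists a finite dimensional algebra $B$ over an algebraically closed field $k$ and an indecomposable wild element $\theta\in K_0(\operatorname{proj}B)$ such that $\operatorname{cone}(\operatorname{ind}\theta)\subsetneq\operatorname{cone}(\operatorname{ind}\mathbb{N}\theta)$. In particular $\theta$ violates the ray condition: $\ell\theta$ is not indecomposable for some $\ell\ge1$.
   Context: For a finite dimensional $k$-algebra $B$, $K_0(\operatorname{proj}B)$ has basis the classes of indecomposable projectives. For $\theta$ write $\theta=[P_0]-[P_1]$ with no common nonzero summands, $\operatorname{Hom}(\theta)=\operatorname{Hom}_B(P_1,P_0)$, $P_f$ the 2-term complex $(P_1\xrightarrow{f}P_0)$ in $\mathsf{K}^b(\operatorname{proj}B)$; ''general'' = in a nonempty Zariski open dense subset. $\theta$ is indecomposable if $P_f$ is indecomposable for general $f$; wild if $\min_{f,g\in\operatorname{Hom}(\theta)}\dim_k\operatorname{Hom}_{\mathsf{K}^b}(P_f,P_g[1])\ne0$. A canonical decomposition $\theta=\theta_1\oplus\cdots\oplus\theta_m$ has $\theta=\sum\theta_i$, each $\theta_i$ indecomposable, and for general $f\in\operatorname{Hom}(\theta)$, $P_f\cong\bigoplus P_{f_i}$ with $f_i\in\operatorname{Hom}(\theta_i)$; it is unique up to order; $\operatorname{ind}\theta=\{\theta_1,\dots,\theta_m\}$, $\operatorname{ind}\mathbb{N}\theta=\bigcup_{\ell\ge1}\operatorname{ind}\ell\theta$, $\operatorname{cone}X=\sum_{x\in X}\mathbb{R}_{\ge0}x$. *)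

(* Defs.v *)
From HB Require Import structures.
From mathcomp Require Import all_boot all_order all_algebra all_field.
From mathcomp Require Import mpoly.
From mathcomp Require Import reals.

Set Implicit Arguments.
Unset Strict Implicit.
Unset Printing Implicit Defensive.

Import Order.TTheory GRing.Theory Num.Theory.
Local Open Scope ring_scope.

Section TwoTerm.

Variables (k : fieldType) (B : falgType k) (n : nat) (e : 'I_n -> B).

(* e : 'I_n -> B is a fixed list of idempotents e_1..e_n; the indecomposable
   projective right B-modules are (up to iso) the e_i B.
   A finitely generated projective  P = (+)_{j : J} e_{lab j} B  is encoded by
   a finite index type J together with a labelling lab : J -> 'I_n. *)
Record proj := Proj { pidx : finType; plab : pidx -> 'I_n }.

(* Ambient space for morphisms P -> Q : matrices indexed (target, source)
   with entries in B.  Hom_B(e_i B, e_j B) = e_j B e_i (left multiplication). *)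
Definition Mor (P Q : proj) := {ffun (pidx Q * pidx P) -> B}.

Definition isHom (P Q : proj) (F : Mor P Q) : Prop :=
  forall jj, F jj = e (@plab Q jj.1) * F jj * e (@plab P jj.2).

Definition comp (P Q R : proj) (G : Mor Q R) (F : Mor P Q) : Mor P R :=
  [ffun ik => \sum_(j : pidx Q) G (ik.1, j) * F (j, ik.2)].

Definition idm (P : proj) : Mor P P :=
  [ffun jj => if jj.1 == jj.2 then e (@plab P jj.1) else 0].

Definition prjHom (P Q : proj) (F : Mor P Q) : Mor P Q :=
  [ffun jj => e (@plab Q jj.1) * F jj * e (@plab P jj.2)].
Definition homsp (P Q : proj) : {vspace Mor P Q} :=
  <<[seq prjHom v | v <- vbasis {: Mor P Q}]>>%VS.

(* 2-term complexes  (c1 --d--> c0)  in K^b(proj B), degrees -1 and 0 *)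
Record cx := Cx { c1 : proj; c0 : proj; d : Mor c1 c0 }.

Record chainMap (X Y : cx) := ChainMap {
  m1 : Mor (c1 X) (c1 Y); m0 : Mor (c0 X) (c0 Y) }.

Definition isChain (X Y : cx) (phi : chainMap X Y) : Prop :=
  [/\ isHom (m1 phi), isHom (m0 phi) &
      comp (m0 phi) (d X) = comp (d Y) (m1 phi)].

Definition cmcomp (X Y Z : cx) (psi : chainMap Y Z) (phi : chainMap X Y)
  : chainMap X Z := ChainMap (comp (m1 psi) (m1 phi)) (comp (m0 psi) (m0 phi)).
Definition cmid (X : cx) : chainMap X X := ChainMap (idm (c1 X)) (idm (c0 X)).
Definition cmzero (X Y : cx) : chainMap X Y := ChainMap 0 0.

Definition homotopic (X Y : cx) (phi psi : chainMap X Y) : Prop :=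
  exists h : Mor (c0 X) (c1 Y), isHom h /\
    m0 phi - m0 psi = comp (d Y) h /\ m1 phi - m1 psi = comp h (d X).

Definition isoK (X Y : cx) : Prop :=
  exists (phi : chainMap X Y) (psi : chainMap Y X),
    [/\ isChain phi, isChain psi,
        homotopic (cmcomp psi phi) (cmid X) &
        homotopic (cmcomp phi psi) (cmid Y)].

(* indecomposable object of K^b(proj B): nonzero, and its endomorphism ring
   has no idempotents other than 0 and 1 (K^b(proj B) is Krull-Schmidt). *)
Definition indecK (X : cx) : Prop :=
  ~ homotopic (cmid X) (cmzero X X) /\
  forall phi : chainMap X X, isChain phi ->
    homotopic (cmcomp phi phi) phi ->
    homotopic phi (cmzero X X) \/ homotopic phi (cmid X).

Definition psum (m : nat) (P : 'I_m -> proj) : proj :=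
  @Proj {i : 'I_m & pidx (P i)} (fun x => @plab (P (tag x)) (tagged x)).

Definition blockdiag (m : nat) (P Q : 'I_m -> proj)
  (A : forall i, Mor (P i) (Q i)) : Mor (psum P) (psum Q) :=
  [ffun ab => match tag ab.2 =P tag ab.1 with
              | ReflectT E => A (tag ab.1) ((tagged ab.1), etagged E)
              | ReflectF _ => 0 end].

Definition cxsum (m : nat) (X : 'I_m -> cx) : cx :=
  @Cx (psum (fun i => c1 (X i))) (psum (fun i => c0 (X i)))
      (blockdiag (fun i => d (X i))).

(* K_0(proj B) = Z^n with basis [e_1 B], ..., [e_n B] *)
Definition K0 := {ffun 'I_n -> int}.

Definition posp (z : int) : nat := if z is Posz m then m else 0%N.
Definition negp (z : int) : nat := if z is Negz m then m.+1 else 0%N.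

Definition projOf (a : 'I_n -> nat) : proj :=
  @Proj {i : 'I_n & 'I_(a i)} (fun x => tag x).

(* theta = [P0] - [P1] with no common summands *)
Definition P0 (th : K0) : proj := projOf (fun i => posp (th i)).
Definition P1 (th : K0) : proj := projOf (fun i => negp (th i)).

Definition HomT (th : K0) := Mor (P1 th) (P0 th).
Definition Pf (th : K0) (f : HomT th) : cx := @Cx (P1 th) (P0 th) f.

Definition coords (V : vectType k) (v : V) : 'I_(\dim {: V}) -> k :=
  fun i => coord (vbasis {: V}) i v.

(* "Pr holds for general f in Hom(P,Q)": Pr holds on a nonempty Zariski open
   subset of the affine space Hom_B(P,Q) (open sets of the subspace topology
   are unions of basic opens {p <> 0}; nonempty opens are dense since affine
   space is irreducible). *)
Definition general (P Q : proj) (Pr : Mor P Q -> Prop) : Prop :=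
  exists p : {mpoly k[\dim {: Mor P Q}]},
    (exists f : Mor P Q, isHom f /\ p.@[coords f] != 0) /\
    (forall f : Mor P Q, isHom f -> p.@[coords f] != 0 -> Pr f).

Definition indecT (th : K0) : Prop :=
  general (fun f : HomT th => indecK (Pf f)).

(* dim_k Hom_{K^b}(P_f, P_g[1]) = dim Hom_B(P1,P0) / {h0 f + g h1} *)
Definition homsp_htp (th : K0) (f g : HomT th) : {vspace HomT th} :=
  (<<[seq comp h f | h <- vbasis (homsp (P0 th) (P0 th))]>> +
   <<[seq comp g h | h <- vbasis (homsp (P1 th) (P1 th))]>>)%VS.

Definition dimHomShift (th : K0) (f g : HomT th) : nat :=
  (\dim (homsp (P1 th) (P0 th)) - \dim (homsp_htp f g))%N.

Definition wildT (th : K0) : Prop :=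
  forall f g : HomT th, isHom f -> isHom g -> dimHomShift f g <> 0%N.

Definition candec (th : K0) (m : nat) (ths : 'I_m -> K0) : Prop :=
  [/\ (forall i, th i = \sum_(j < m) ths j i),
      (forall j, indecT (ths j)) &
      general (fun f : HomT th =>
        exists fs : forall j, HomT (ths j),
          (forall j, isHom (fs j)) /\
          isoK (Pf f) (cxsum (fun j => Pf (fs j))))].

Definition ind (th : K0) (x : K0) : Prop :=
  exists (m : nat) (ths : 'I_m -> K0), candec th ths /\ exists j, ths j = x.

Definition indN (th : K0) (x : K0) : Prop :=
  exists l : nat, (0 < l)%N /\ ind [ffun i => th i *+ l] x.

Definition cone (R : realType) (X : K0 -> Prop) (v : 'I_n -> R) : Prop :=
  exists s : seq (R * K0),
    (forall cx, cx \in s -> 0 <= cx.1 /\ X cx.2) /\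
    forall i, v i = \sum_(cx <- s) cx.1 * (cx.2 i)%:~R.

End TwoTerm.

(* e_1, ..., e_n is a complete list of representatives of the indecomposable
   projective right B-modules e_i B, up to isomorphism, so that
   K_0(proj B) = Z^n with basis [e_i B]. *)
Definition isoIdem (k : fieldType) (B : falgType k) (u v : B) : Prop :=
  (* u B ~= v B as right B-modules *)
  exists a b : B, [/\ a = v * a * u, b = u * b * v, a * b = v & b * a = u].

Definition localIdem (k : fieldType) (B : falgType k) (u : B) : Prop :=
  (* u is a nonzero idempotent with u B u a local ring, i.e. u B indecomposable *)
  [/\ u * u = u, u != 0 &
      forall x : B, x = u * x * u ->
        (exists y, y = u * y * u /\ x * y = u /\ y * x = u) \/
        (exists y, y = u * y * u /\ (u - x) * y = u /\ y * (u - x) = u)].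

Definition completeIdems (k : fieldType) (B : falgType k) (n : nat)
  (e : 'I_n -> B) : Prop :=
  [/\ (forall i, localIdem (e i)),
      (forall i j, isoIdem (e i) (e j) -> i = j) &
      exists (m : nat) (u : 'I_m -> B),
        [/\ \sum_(i < m) u i = 1,
            (forall i j, i != j -> u i * u j = 0),
            (forall i, localIdem (u i)) &
            (forall i, exists j, isoIdem (u i) (e j))]].

(* Main.v *)
(* Let B be the algebra with three indecomposable projectives P, Q, R such that
   Hom(R, Q), Hom(Q, P) and Hom(R, P) are copies of k^3 and composition is the
   cross product, and let theta = [P] + [Q] - [R].  A map R -> P + Q is a pair
   (z, y) of vectors, and P splits off iff z lies in the image of the map
   v |-> v x y (cross product), the orthogonal complement of y; its matrix is
   skew-symmetric of size 3, hence singular, so that generically P does not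
   split off and theta is indecomposable.  For
   2 theta the vector y becomes a 2 x 2 matrix of vectors, that is, three matrices
   Y_0, Y_1, Y_2, and the corresponding map on pairs of rows is a 6 x 6 matrix
   which for Y_2 = 1 is invertible as soon as the commutator [Y_0, Y_1] is.  So
   2 theta = (2[Q] - 2[R]) + [P] + [P], the first summand being indecomposable
   because only scalars commute with both Y_0 and Y_1.  Hence [P] belongs to
   ind(N theta), whereas ind(theta) = {theta}. *)
Require Import Defs.
From HB Require Import structures.
From mathcomp Require Import all_boot all_order all_algebra all_field.
From mathcomp Require Import mpoly.
From mathcomp Require Import reals.
From mathcomp Require Import ring.
Local Open Scope ring_scope.

Set Implicit Arguments.
Unset Strict Implicit.
Unset Printing Implicit Defensive.

Import GRing.Theory Num.Theory.

(** * The algebra *)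

(** The definitions speak of homotopies and of Zariski open sets; both are brought down to matrices
    over k. There are no nonzero maps from P or Q to R, so no nonzero homotopies between the model
    complexes below: endomorphisms up to homotopy are honest pairs of matrices, and
    indecomposability is a computation of idempotents. Each generic condition is the nonvanishing of
    one explicit polynomial, namely the scalar product of z and y for [theta], and [discriminant]
    for [kronecker] and [theta2]; adjugates replace inverses to keep it polynomial. The complexes
    [Pf f] are indexed by dependent pairs. Computations are made on models indexed by ordinals and
    carried over along label-preserving bijections, which induce isomorphisms of complexes. Since
    [ind theta] collects the members of every canonical decomposition, uniqueness has to be shown
    for the indecomposable element [theta]. The cone of [ind theta] is then a ray on which the
    coordinates at P and Q agree, and [P] is not on it. *)

Section CrossProduct.
Variable k : fieldType.
Implicit Types x y : 'rV[k]_3.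

(** Indices in ['I_3] are added modulo 3, so one cyclic formula gives all three coordinates. *)
Definition cross x y : 'rV[k]_3 :=
  \row_i (x 0 (i + 1) * y 0 (i + 2%:R) - x 0 (i + 2%:R) * y 0 (i + 1)).

Lemma cross0l y : cross 0 y = 0.
Proof. by apply/rowP => i; rewrite !mxE; ring. Qed.

Lemma cross0r x : cross x 0 = 0.
Proof. by apply/rowP => i; rewrite !mxE; ring. Qed.

End CrossProduct.

(* The path algebra of the quiver with three arrows 2 -> 1 and three arrows
   1 -> 0 modulo the relations making the paths of length 2 the exterior square
   of k^3. The tuple (a, b, c, x, y, z) stands for the upper triangular matrix
   [[a, x, z], [0, b, y], [0, 0, c]]. *)
Definition crossAlg (k : fieldType) : Type :=
  (k^o * k^o * k^o * 'rV[k]_3 * 'rV[k]_3 * 'rV[k]_3)%type.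

HB.instance Definition _ (k : fieldType) := Vector.copy (crossAlg k)
  (k^o * k^o * k^o * 'rV[k]_3 * 'rV[k]_3 * 'rV[k]_3)%type.

Section CrossAlg.
Variable k : fieldType.
Notation B := (crossAlg k).
Implicit Types u v w : B.

Definition pa u : k := u.1.1.1.1.1.
Definition pb u : k := u.1.1.1.1.2.
Definition pc u : k := u.1.1.1.2.
Definition px u : 'rV[k]_3 := u.1.1.2.
Definition py u : 'rV[k]_3 := u.1.2.
Definition pz u : 'rV[k]_3 := u.2.

Definition mkB (a b c : k) (x y z : 'rV[k]_3) : B := (a, b, c, x, y, z).

Lemma crossAlgP u v :
  [/\ pa u = pa v, pb u = pb v & pc u = pc v] ->
  [/\ px u = px v, py u = py v & pz u = pz v] -> u = v.
Proof.
case: u => [[[[[a b] c] x] y] z]; case: v => [[[[[a' b'] c'] x'] y'] z'].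
by rewrite /pa /pb /pc /px /py /pz /= => -[-> -> ->] [-> -> ->].
Qed.

Definition oneB : B := mkB 1 1 1 0 0 0.
Definition mulB u v : B :=
  mkB (pa u * pa v) (pb u * pb v) (pc u * pc v)
      (pa u *: px v + pb v *: px u)
      (pb u *: py v + pc v *: py u)
      (pa u *: pz v + cross (px u) (py v) + pc v *: pz u).

(** The quiver has no paths of length 3, so associativity comes down to the bilinearity of
    [cross]. *)
Fact mulBA : associative mulB.
Proof.
move=> u v w; apply: crossAlgP; split; rewrite /mulB /pa /pb /pc /px /py /pz /=;
  rewrite ?mulrA //; apply/rowP => i; rewrite !mxE; ring.
Qed.
Fact mul1B : left_id oneB mulB.
Proof.
move=> u; apply: crossAlgP; split; rewrite /mulB /pa /pb /pc /px /py /pz /=;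
  rewrite ?mul1r //; apply/rowP => i; rewrite !mxE; ring.
Qed.
Fact mulB1 : right_id oneB mulB.
Proof.
move=> u; apply: crossAlgP; split; rewrite /mulB /pa /pb /pc /px /py /pz /=;
  rewrite ?mulr1 //; apply/rowP => i; rewrite !mxE; ring.
Qed.
Fact mulBDl : left_distributive mulB +%R.
Proof.
move=> u v w; apply: crossAlgP; split; rewrite /mulB /pa /pb /pc /px /py /pz /=;
  rewrite ?mulrDl //; apply/rowP => i; rewrite !mxE; ring.
Qed.
Fact mulBDr : right_distributive mulB +%R.
Proof.
move=> u v w; apply: crossAlgP; split; rewrite /mulB /pa /pb /pc /px /py /pz /=;
  rewrite ?mulrDr //; apply/rowP => i; rewrite !mxE; ring.
Qed.
Fact oneB_neq0 : oneB != 0.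
Proof. by apply/eqP => /(congr1 pa)/eqP; rewrite /pa /= oner_eq0. Qed.

HB.instance Definition _ := GRing.Zmodule_isNzRing.Build B
  mulBA mul1B mulB1 mulBDl mulBDr oneB_neq0.

Fact scaleBAl (a : k) u v : a *: (u * v) = (a *: u) * v.
Proof.
apply: crossAlgP; split; rewrite /GRing.mul /= /mulB /pa /pb /pc /px /py /pz /=;
  rewrite /GRing.scale /= ?mulrA //; apply/rowP => i; rewrite !mxE; ring.
Qed.
HB.instance Definition _ := GRing.Lmodule_isLalgebra.Build k B scaleBAl.

Fact scaleBAr (a : k) u v : a *: (u * v) = u * (a *: v).
Proof.
apply: crossAlgP; split; rewrite /GRing.mul /= /mulB /pa /pb /pc /px /py /pz /=;
  rewrite /GRing.scale /= ?(mulrCA a) //; apply/rowP => i; rewrite !mxE; ring.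
Qed.
HB.instance Definition _ := GRing.Lalgebra_isAlgebra.Build k B scaleBAr.
HB.instance Definition _ := Algebra_isFalgebra.Build k B.

End CrossAlg.

(** * The homotopy category of two-term complexes *)

Section HomotopyCategory.
Variables (k : fieldType) (B : falgType k) (n : nat) (e : 'I_n -> B).
Hypothesis ee : forall i, e i * e i = e i.
Local Notation proj := (proj n).
Local Notation cx := (cx B n).
Local Notation Mor := (Mor B).
Local Notation "G \c F" := (Defs.comp G F) (at level 40, left associativity).
Local Notation isHom := (isHom e).
Local Notation idm := (idm e).
Local Notation homotopic := (homotopic e).
Local Notation isChain := (isChain e).
Local Notation isoK := (isoK e).
Implicit Types (P Q R S : proj) (X Y Z : cx).

Lemma compE P Q R (G : Mor Q R) (F : Mor P Q) i l :
  (G \c F) (i, l) = \sum_j G (i, j) * F (j, l).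
Proof. by rewrite ffunE. Qed.

Lemma isHom_mull P Q (F : Mor P Q) jj : isHom F -> e (plab jj.1) * F jj = F jj.
Proof. by move=> hF; rewrite hF !mulrA ee. Qed.

Lemma isHom_mulr P Q (F : Mor P Q) jj : isHom F -> F jj * e (plab jj.2) = F jj.
Proof. by move=> hF; rewrite hF -!mulrA ee. Qed.

Lemma isHomP P Q (F : Mor P Q) :
  (forall jj, e (plab jj.1) * F jj = F jj) ->
  (forall jj, F jj * e (plab jj.2) = F jj) -> isHom F.
Proof. by move=> hl hr jj; rewrite hl hr. Qed.

Lemma isHom_comp P Q R (G : Mor Q R) (F : Mor P Q) :
  isHom G -> isHom F -> isHom (G \c F).
Proof.
move=> hG hF; apply: isHomP => -[i l] /=; rewrite compE.
  by rewrite mulr_sumr; apply: eq_bigr => j _; rewrite mulrA (isHom_mull (i, j)).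
by rewrite mulr_suml; apply: eq_bigr => j _; rewrite -mulrA (isHom_mulr (j, l)).
Qed.

Lemma isHom0 P Q : isHom (0 : Mor P Q).
Proof. by move=> jj; rewrite !ffunE mulr0 mul0r. Qed.

Lemma isHomD P Q (F G : Mor P Q) : isHom F -> isHom G -> isHom (F + G).
Proof. by move=> hF hG jj; rewrite !ffunE mulrDr mulrDl -hF -hG. Qed.

Lemma isHomN P Q (F : Mor P Q) : isHom F -> isHom (- F).
Proof. by move=> hF jj; rewrite !ffunE mulrN mulNr -hF. Qed.

Lemma isHomZ P Q a (F : Mor P Q) : isHom F -> isHom (a *: F).
Proof. by move=> hF jj; rewrite !ffunE -scalerAr -scalerAl -hF. Qed.

Lemma isHom_idm P : isHom (idm P).
Proof.
by move=> [i j]; rewrite !ffunE /=; case: eqP => [->|_];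
  rewrite ?ee ?mulr0 ?mul0r.
Qed.

Lemma compA P Q R S (H : Mor R S) (G : Mor Q R) (F : Mor P Q) :
  H \c (G \c F) = H \c G \c F.
Proof.
apply/ffunP => -[i l]; rewrite !compE.
under eq_bigr do rewrite compE mulr_sumr.
rewrite exchange_big /=; apply: eq_bigr => j _.
by rewrite compE mulr_suml; apply: eq_bigr => j' _; rewrite mulrA.
Qed.

Lemma compDl P Q R (G G' : Mor Q R) (F : Mor P Q) :
  (G + G') \c F = G \c F + G' \c F.
Proof.
apply/ffunP => -[i l]; rewrite !ffunE -big_split /=.
by apply: eq_bigr => j _; rewrite ffunE mulrDl.
Qed.

Lemma compDr P Q R (G : Mor Q R) (F F' : Mor P Q) :
  G \c (F + F') = G \c F + G \c F'.
Proof.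
apply/ffunP => -[i l]; rewrite !ffunE -big_split /=.
by apply: eq_bigr => j _; rewrite ffunE mulrDr.
Qed.

Lemma compNl P Q R (G : Mor Q R) (F : Mor P Q) : (- G) \c F = - (G \c F).
Proof.
apply/ffunP => -[i l]; rewrite !ffunE -sumrN.
by apply: eq_bigr => j _; rewrite ffunE mulNr.
Qed.

Lemma compNr P Q R (G : Mor Q R) (F : Mor P Q) : G \c (- F) = - (G \c F).
Proof.
apply/ffunP => -[i l]; rewrite !ffunE -sumrN.
by apply: eq_bigr => j _; rewrite ffunE mulrN.
Qed.

Lemma comp0l P Q R (F : Mor P Q) : (0 : Mor Q R) \c F = 0.
Proof.
by apply/ffunP => -[i l]; rewrite !ffunE big1 // => j _; rewrite ffunE mul0r.
Qed.

Lemma comp0r P Q R (G : Mor Q R) : G \c (0 : Mor P Q) = 0.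
Proof.
by apply/ffunP => -[i l]; rewrite !ffunE big1 // => j _; rewrite ffunE mulr0.
Qed.

Lemma comp_idl P Q (F : Mor P Q) : isHom F -> idm Q \c F = F.
Proof.
move=> hF; apply/ffunP => -[i l]; rewrite !ffunE (bigD1 i) //= ffunE eqxx.
rewrite (isHom_mull (i, l)) // big1 ?addr0 // => j /negPf ji.
by rewrite ffunE /= eq_sym ji mul0r.
Qed.

Lemma comp_idr P Q (F : Mor P Q) : isHom F -> F \c idm P = F.
Proof.
move=> hF; apply/ffunP => -[i l]; rewrite !ffunE (bigD1 l) //= ffunE eqxx.
rewrite (isHom_mulr (i, l)) // big1 ?addr0 // => j /negPf jl.
by rewrite ffunE /= jl mulr0.
Qed.

Lemma homotopic_refl X Y (f : chainMap X Y) : homotopic f f.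
Proof. by exists 0; rewrite !subrr comp0l comp0r; split=> //; apply: isHom0. Qed.

Lemma homotopic_sym X Y (f g : chainMap X Y) : homotopic f g -> homotopic g f.
Proof.
case=> h [hh [h0 h1]]; exists (- h); rewrite compNl compNr -h0 -h1 !opprB.
by split=> //; apply: isHomN.
Qed.

Lemma homotopic_trans X Y (f g h : chainMap X Y) :
  homotopic f g -> homotopic g h -> homotopic f h.
Proof.
case=> s [hs [s0 s1]] [t [ht [t0 t1]]]; exists (s + t).
by rewrite compDl compDr -s0 -s1 -t0 -t1 !addrA !subrK; split=> //; apply: isHomD.
Qed.

Lemma homotopic_comp X Y Z (f f' : chainMap X Y) (g g' : chainMap Y Z) :
  isChain g -> isChain f' -> homotopic f f' -> homotopic g g' ->
  homotopic (cmcomp g f) (cmcomp g' f').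
Proof.
move=> [g1 g0 gd] [f1 f0 fd] [s [hs [s0 s1]]] [t [ht [t0 t1]]].
(* This comes from writing gf - g'f' as g(f - f') + (g - g')f'. *)
exists (m1 g \c s + t \c m0 f'); split; first by apply: isHomD; apply: isHom_comp.
have comp_sub P Q R (G G' : Mor Q R) (F F' : Mor P Q) :
    G \c F - G' \c F' = G \c (F - F') + (G - G') \c F'.
  by rewrite compDr compDl compNr compNl addrA subrK.
rewrite /= !comp_sub s0 s1 t0 t1 compDr compDl !compA gd.
by split=> //; rewrite -!compA fd.
Qed.

Lemma cmcompA W X Y Z (h : chainMap Y Z) (g : chainMap X Y) (f : chainMap W X) :
  cmcomp h (cmcomp g f) = cmcomp (cmcomp h g) f.
Proof. by rewrite /cmcomp /= !compA. Qed.

Lemma cmcomp_idl X Y (f : chainMap X Y) :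
  isChain f -> cmcomp (cmid e Y) f = f.
Proof. by case: f => f1 f0 [/= h1 h0 _]; rewrite /cmcomp /= !comp_idl. Qed.

Lemma cmcomp_idr X Y (f : chainMap X Y) :
  isChain f -> cmcomp f (cmid e X) = f.
Proof. by case: f => f1 f0 [/= h1 h0 _]; rewrite /cmcomp /= !comp_idr. Qed.

Lemma cmcomp0l X Y Z (f : chainMap X Y) : cmcomp (cmzero Y Z) f = cmzero X Z.
Proof. by rewrite /cmcomp /= !comp0l. Qed.

Lemma cmcomp0r X Y Z (g : chainMap Y Z) : cmcomp g (cmzero X Y) = cmzero X Z.
Proof. by rewrite /cmcomp /= !comp0r. Qed.

Lemma isChain_comp X Y Z (g : chainMap Y Z) (f : chainMap X Y) :
  isChain g -> isChain f -> isChain (cmcomp g f).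
Proof.
move=> [g1 g0 gd] [f1 f0 fd]; split; try exact: isHom_comp.
by rewrite /= -compA fd !compA gd.
Qed.

Lemma isChain_id X : isHom (d X) -> isChain (cmid e X).
Proof. by move=> hX; split; rewrite /= ?comp_idl ?comp_idr //; apply: isHom_idm. Qed.

Lemma isChain_zero X Y : isChain (cmzero X Y).
Proof. by split; rewrite /= ?comp0l ?comp0r //; apply: isHom0. Qed.

Lemma homotopic_compl X Y Z (f f' : chainMap X Y) (g : chainMap Y Z) :
  isChain g -> isChain f' -> homotopic f f' ->
  homotopic (cmcomp g f) (cmcomp g f').
Proof. by move=> hg hf ff; apply: homotopic_comp => //; apply: homotopic_refl. Qed.

Lemma homotopic_compr X Y Z (f : chainMap X Y) (g g' : chainMap Y Z) :
  isChain g -> isChain f -> homotopic g g' ->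
  homotopic (cmcomp g f) (cmcomp g' f).
Proof. by move=> hg hf ff; apply: homotopic_comp => //; apply: homotopic_refl. Qed.

Lemma isoK_sym X Y : isoK X Y -> isoK Y X.
Proof. by case=> f [g [hf hg gf fg]]; exists g, f. Qed.

Lemma isoK_trans X Y Z : isHom (d X) -> isHom (d Y) -> isHom (d Z) ->
  isoK X Y -> isoK Y Z -> isoK X Z.
Proof.
move=> hX hY hZ [f [f' [hf hf' f'f ff']]] [g [g' [hg hg' g'g gg']]].
exists (cmcomp g f), (cmcomp f' g'); split; try exact: isChain_comp.
  apply: homotopic_trans f'f; rewrite -cmcompA (cmcompA g').
  rewrite -[X in homotopic _ (cmcomp f' X)](cmcomp_idl hf).
  apply: homotopic_compl => //; first by apply: isChain_comp => //; apply: isChain_id.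
  by apply: homotopic_compr => //; apply: isChain_comp.
apply: homotopic_trans gg'; rewrite -cmcompA (cmcompA f).
rewrite -[X in homotopic _ (cmcomp g X)](cmcomp_idl hg').
apply: homotopic_compl => //; first by apply: isChain_comp => //; apply: isChain_id.
by apply: homotopic_compr => //; apply: isChain_comp.
Qed.

(** An endomorphism u of Y is conjugated to v = g u f on X. As g and f are inverse only up to
    homotopy, so is the idempotency of v and the recovery of u from v. *)
Lemma indecK_iso X Y : isHom (d X) -> isHom (d Y) ->
  isoK X Y -> indecK e X -> indecK e Y.
Proof.
move=> hX hY [f [g [hf hg gf fg]]] [X0 Xid].
have iX := isChain_id hX; have iY := isChain_id hY.
have conj_htp (u u' : chainMap X X) : isChain u -> isChain u' ->
    homotopic u u' -> homotopic (cmcomp (cmcomp f u) g) (cmcomp (cmcomp f u') g).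
  move=> hu hu' uu'; apply: homotopic_compr => //; first exact: isChain_comp.
  exact: homotopic_compl.
split.
  move=> Y0; apply: X0; apply: homotopic_trans (homotopic_sym gf) _.
  rewrite -[f in cmcomp g f](cmcomp_idl hf) -(cmcomp0r X g) -(cmcomp0l Y f).
  apply: homotopic_compl => //; first by apply: isChain_comp => //; apply: isChain_zero.
  exact: homotopic_compr.
move=> u hu uu; pose v := cmcomp (cmcomp g u) f.
have hgu : isChain (cmcomp g u) by apply: isChain_comp.
have huf : isChain (cmcomp u f) by apply: isChain_comp.
have hv : isChain v by apply: isChain_comp.
have vv : homotopic (cmcomp v v) v.
  rewrite /v -(cmcompA _ _ (cmcomp _ f)) -(cmcompA g u f) (cmcompA f).
  apply: (@homotopic_trans _ _ _ (cmcomp (cmcomp g u) (cmcomp u f))).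
    rewrite -[X in homotopic _ (cmcomp _ X)](cmcomp_idl huf).
    apply: homotopic_compl => //; first exact: isChain_comp.
    by apply: homotopic_compr => //; apply: isChain_comp.
  rewrite -cmcompA; apply: homotopic_compl => //; rewrite cmcompA.
  by apply: homotopic_compr => //; apply: isChain_comp.
have uv : homotopic u (cmcomp (cmcomp f v) g).
  have hfg : isChain (cmcomp f g) by apply: isChain_comp.
  rewrite /v -!cmcompA (cmcompA f g) -[X in homotopic X _](cmcomp_idl hu).
  apply: homotopic_comp => //; try exact: isChain_comp.
    rewrite -[X in homotopic X _](cmcomp_idr hu).
    by apply: homotopic_compl => //; apply: homotopic_sym.
  exact: homotopic_sym.
case: (Xid v hv vv) => [v0|v1]; [left|right]; apply: homotopic_trans uv _.
  rewrite -(cmcomp0l Y g) -(cmcomp0r X f).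
  by apply: conj_htp => //; apply: isChain_zero.
by apply: homotopic_trans fg; rewrite -[X in homotopic _ (cmcomp X g)](cmcomp_idr hf);
  apply: conj_htp.
Qed.

Lemma isoK_strict X Y (f : chainMap X Y) (g : chainMap Y X) :
  isChain f -> isChain g -> cmcomp g f = cmid e X -> cmcomp f g = cmid e Y ->
  isoK X Y.
Proof.
by move=> hf hg gf fg; exists f, g; rewrite gf fg; split=> //; apply: homotopic_refl.
Qed.

Definition mapm P Q (s : pidx P -> pidx Q) : Mor P Q :=
  [ffun ij => if ij.1 == s ij.2 then e (plab ij.1) else 0].

Definition label_preserving P Q (s : pidx P -> pidx Q) := forall i, plab (s i) = plab i.

Lemma isHom_mapm P Q (s : pidx P -> pidx Q) : label_preserving s -> isHom (mapm s).
Proof.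
move=> sl [i j]; rewrite !ffunE /=; case: eqP => [->|_]; last by rewrite mulr0 mul0r.
by rewrite sl !ee.
Qed.

Definition pullm P Q P' Q' (s : pidx P' -> pidx P) (t : pidx Q' -> pidx Q)
  (F : Mor P Q) : Mor P' Q' := [ffun ij => F (t ij.1, s ij.2)].

Lemma isHom_pullm P Q P' Q' (s : pidx P' -> pidx P) (t : pidx Q' -> pidx Q)
    (F : Mor P Q) :
  label_preserving s -> label_preserving t -> isHom F -> isHom (pullm s t F).
Proof. by move=> sl tl hF [i j]; rewrite !ffunE /= {1}hF /= sl tl. Qed.

Lemma comp_mapm P Q R (G : Mor Q R) (s : pidx P -> pidx Q) : label_preserving s ->
  isHom G -> G \c mapm s = [ffun ij => G (ij.1, s ij.2)].
Proof.
move=> sl hG; apply/ffunP => -[i j]; rewrite compE (bigD1 (s j)) //= !ffunE eqxx.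
rewrite (isHom_mulr (i, s j)) // big1 ?addr0 // => l /negPf lj.
by rewrite ffunE /= lj mulr0.
Qed.

Lemma mapm_comp P Q R (F : Mor P Q) (s : pidx Q -> pidx R) t :
  cancel s t -> cancel t s -> label_preserving s ->
  isHom F -> mapm s \c F = [ffun ij => F (t ij.1, ij.2)].
Proof.
move=> st ts sl hF; apply/ffunP => -[i j].
rewrite compE (bigD1 (t i)) //= !ffunE /= ts eqxx -{1}(ts i) sl.
rewrite (isHom_mull (t i, j)) // big1 ?addr0 // => l /negPf lj.
by rewrite ffunE /= eq_sym (can2_eq st ts) lj mul0r.
Qed.

(** Renaming the indices is conjugation by the permutation matrices [mapm], so the isomorphism is
    strict. *)
Lemma pullm_isoK P Q P' Q' (s : pidx P' -> pidx P) s' (t : pidx Q' -> pidx Q) t'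
    (F : Mor P Q) :
  cancel s s' -> cancel s' s -> cancel t t' -> cancel t' t ->
  label_preserving s -> label_preserving t -> isHom F ->
  isoK (Cx (pullm s t F)) (Cx F).
Proof.
move=> ss s's tt t't sl tl hF.
have sl' : label_preserving s' by move=> i; rewrite -sl s's.
have tl' : label_preserving t' by move=> i; rewrite -tl t't.
have hF' := isHom_pullm sl tl hF.
apply: (@isoK_strict (Cx (pullm s t F)) (Cx F)
  (@ChainMap _ _ _ (Cx (pullm s t F)) (Cx F) (mapm s) (mapm t))
  (@ChainMap _ _ _ (Cx F) (Cx (pullm s t F)) (mapm s') (mapm t'))).
- split=> /=; try exact: isHom_mapm.
  rewrite (mapm_comp tt) // comp_mapm //; apply/ffunP => -[i j].
  by rewrite !ffunE /= t't.
- split=> /=; try exact: isHom_mapm.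
  rewrite (mapm_comp t't) // comp_mapm //; apply/ffunP => -[i j].
  by rewrite !ffunE /= s's.
- rewrite /cmcomp /cmid /=; congr ChainMap;
    rewrite comp_mapm ?mapm_comp //; try exact: isHom_mapm;
    apply/ffunP => -[i j]; rewrite !ffunE /=.
    by rewrite ss.
  by rewrite tt.
- rewrite /cmcomp /cmid /=; congr ChainMap;
    rewrite comp_mapm //; try exact: isHom_mapm;
    apply/ffunP => -[i j]; rewrite !ffunE /=.
    by rewrite s's.
  by rewrite t't.
Qed.

End HomotopyCategory.

(** * Direct sums of complexes and matching of labels *)

Lemma big_tagged (R : Type) (idx : R) (op : Monoid.com_law idx) (I : finType)
    (T : I -> finType) (P : pred {i : I & T i}) (F : {i : I & T i} -> R) :
  \big[op/idx]_(a | P a) F a =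
  \big[op/idx]_i \big[op/idx]_(x : T i | P (Tagged T x)) F (Tagged T x).
Proof. by rewrite sig_big_dep; apply: eq_big => -[]. Qed.

Section DirectSums.
Variables (k : fieldType) (B : falgType k) (n : nat) (e : 'I_n -> B).
Hypothesis ee : forall i, e i * e i = e i.
Local Notation Mor := (Mor B).
Local Notation "G \c F" := (Defs.comp G F) (at level 40, left associativity).

Lemma blockdiagE m (P Q : 'I_m -> proj n) (A : forall i, Mor (P i) (Q i))
    j (q : pidx (Q j)) (p : pidx (P j)) :
  blockdiag A (existT _ j q : pidx (psum Q), existT _ j p : pidx (psum P)) =
  A j (q, p).
Proof.
rewrite ffunE /=; case: eqP => // E.
by rewrite /etagged /= (eq_irrelevance E (erefl j)).
Qed.

Lemma blockdiag_neq m (P Q : 'I_m -> proj n) (A : forall i, Mor (P i) (Q i))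
    (a : pidx (psum Q)) (b : pidx (psum P)) :
  tag a != tag b -> blockdiag A (a, b) = 0.
Proof. by move=> ab; rewrite ffunE /=; case: eqP => // ba; rewrite ba eqxx in ab. Qed.

Lemma isHom_blockdiag m (P Q : 'I_m -> proj n) (A : forall i, Mor (P i) (Q i)) :
  (forall i, isHom e (A i)) -> isHom e (blockdiag A).
Proof.
move=> hA [[i q] [j p]] /=; case: (altP (i =P j)) => [ij|ij].
  by subst j; rewrite blockdiagE {1}hA.
by rewrite blockdiag_neq // mulr0 mul0r.
Qed.

(** A homotopy of a direct sum need not be block diagonal. As the differentials are, its diagonal
    blocks are still homotopies of the summands, by [block_compl] and [block_compr]. *)
Definition block m (P Q : 'I_m -> proj n) (j : 'I_m) (F : Mor (psum P) (psum Q)) :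
    Mor (P j) (Q j) :=
  [ffun ij => F (existT _ j ij.1 : pidx (psum Q), existT _ j ij.2 : pidx (psum P))].

Lemma blockE m (P Q : 'I_m -> proj n) j (F : Mor (psum P) (psum Q)) q p :
  block j F (q, p) =
  F (existT _ j q : pidx (psum Q), existT _ j p : pidx (psum P)).
Proof. by rewrite ffunE. Qed.

Lemma block_compl m (P Q R : 'I_m -> proj n) (A : forall i, Mor (Q i) (R i))
    (F : Mor (psum P) (psum Q)) j :
  block j (blockdiag A \c F) = A j \c block j F.
Proof.
apply/ffunP => -[r p]; rewrite ffunE !compE.
rewrite big_tagged (bigD1 j) //= [X in _ + X]big1 ?addr0 => [|i ij]; last first.
  by apply: big1 => q _; rewrite blockdiag_neq ?mul0r //= eq_sym.
by apply: eq_bigr => q _; rewrite blockdiagE ffunE.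
Qed.

Lemma block_compr m (P Q R : 'I_m -> proj n) (A : forall i, Mor (P i) (Q i))
    (F : Mor (psum Q) (psum R)) j :
  block j (F \c blockdiag A) = block j F \c A j.
Proof.
apply/ffunP => -[r p]; rewrite ffunE !compE.
rewrite big_tagged (bigD1 j) //= [X in _ + X]big1 ?addr0 => [|i ij]; last first.
  by apply: big1 => q _; rewrite blockdiag_neq ?mulr0.
by apply: eq_bigr => q _; rewrite blockdiagE ffunE.
Qed.

Lemma isHom_block m (P Q : 'I_m -> proj n) j (F : Mor (psum P) (psum Q)) :
  isHom e F -> isHom e (block j F).
Proof. by move=> hF [q p]; rewrite ffunE /= {1}hF. Qed.

Definition sumproj m (P : 'I_m -> proj n) (j : 'I_m) : Mor (psum P) (psum P) :=
  blockdiag (fun i => if i == j then idm e (P i) else 0).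

Lemma block_sumproj m (P : 'I_m -> proj n) j i :
  block i (sumproj P j) = if i == j then idm e (P i) else 0.
Proof. by apply/ffunP => -[q p]; rewrite blockE blockdiagE. Qed.

Lemma blockP m (P Q : 'I_m -> proj n) (F G : Mor (psum P) (psum Q)) :
  (forall a b, tag a != tag b -> F (a, b) = G (a, b)) ->
  (forall j, block j F = block j G) -> F = G.
Proof.
move=> FG bFG; apply/ffunP => -[[i q] [j p]].
case: (altP (i =P j)) => [ij|ij]; last exact: FG.
subst j.
by have /ffunP/(_ (q, p)) := bFG i; rewrite !ffunE.
Qed.

Lemma blockdiag_comp m (P Q R : 'I_m -> proj n) (A : forall i, Mor (P i) (Q i))
    (A' : forall i, Mor (Q i) (R i)) :
  blockdiag A' \c blockdiag A = blockdiag (fun i => A' i \c A i).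
Proof.
apply: blockP => [a b ab|j].
  rewrite blockdiag_neq // compE big1 // => c _.
  case: (altP (tag a =P tag c)) => [ac|ac].
    by rewrite [X in _ * X]blockdiag_neq ?mulr0 // -ac.
  by rewrite blockdiag_neq ?mul0r.
rewrite block_compl; apply/ffunP => -[q p]; rewrite blockE blockdiagE !compE.
by apply: eq_bigr => l _; rewrite blockE blockdiagE.
Qed.

(* If the projector onto one summand is homotopic to 0, that summand is
   contractible; if it is homotopic to 1, all the others are. *)
Lemma cxsum_indecK m (X : 'I_m -> cx B n) : (forall i, isHom e (d (X i))) ->
  indecK e (cxsum X) ->
  (forall i, ~ homotopic e (cmid e (X i)) (cmzero (X i) (X i))) ->
  m = 1%N.
Proof.
move=> hX [nz idem] ncontr.
pose pr j := @ChainMap _ _ _ (cxsum X) (cxsum X)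
  (sumproj (fun i => c1 (X i)) j) (sumproj (fun i => c0 (X i)) j).
have hpr (P : 'I_m -> proj n) j : isHom e (sumproj P j).
  by apply: isHom_blockdiag => i; case: eqP => _; [exact: isHom_idm | exact: isHom0].
have cpr j : isChain e (pr j).
  split=> //=; rewrite !blockdiag_comp; apply/ffunP => -[a b]; congr ((_ : Mor _ _) (a, b)).
  apply: blockP => [c c' cc'|i]; first by rewrite !blockdiag_neq.
  apply/ffunP => -[q p]; rewrite !blockE !blockdiagE; case: eqP => _.
    by rewrite comp_idl ?comp_idr.
  by rewrite comp0l comp0r.
have prpr j : cmcomp (pr j) (pr j) = pr j.
  rewrite /cmcomp /=; congr ChainMap; rewrite blockdiag_comp;
  apply: blockP => [c c' cc'|i]; try (by rewrite !blockdiag_neq);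
  rewrite block_sumproj; apply/ffunP => -[q p]; rewrite blockE blockdiagE;
  case: eqP => _; rewrite ?comp0l // comp_idl //; exact: isHom_idm.
(* If f and g are homotopic and differ by the identity on summand i, the i-th diagonal block of the
   homotopy contracts that summand. *)
have contr i (f g : chainMap (cxsum X) (cxsum X)) : homotopic e f g ->
    block i (m1 f - m1 g) = idm e (c1 (X i)) ->
    block i (m0 f - m0 g) = idm e (c0 (X i)) -> False.
  case=> h [hh [h0 h1]]; rewrite h0 h1 /= block_compl block_compr => e1 e0.
  apply: (ncontr i); exists (block i h).
  by rewrite /= !subr0 -e0 -e1; split=> //; apply: isHom_block.
have blockB (P Q : 'I_m -> proj n) i (F G : Mor (psum P) (psum Q)) :
    block i (F - G) = block i F - block i G.
  by apply/ffunP => ij; rewrite !ffunE.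
have block0 (P Q : 'I_m -> proj n) i : block i (0 : Mor (psum P) (psum Q)) = 0.
  by apply/ffunP => ij; rewrite !ffunE.
have block1 (P : 'I_m -> proj n) i : block i (idm e (psum P)) = idm e (P i).
  apply/ffunP => -[q p]; rewrite !ffunE /=.
  by rewrite -tag_eqE /tag_eq /= eqxx tagged_asE.
have m_gt0 : (0 < m)%N.
  rewrite lt0n; apply/eqP => m0; have no_idx (i : 'I_m) : False by case: i => i; rewrite m0.
  apply: nz; exists 0; split; first exact: isHom0.
  by split; apply/ffunP => -[[i ?] ?]; by case: (no_idx i).
have all1 (i j : 'I_m) : i = j.
  apply/eqP/negPn/negP => ij.
  have hprj : homotopic e (cmcomp (pr j) (pr j)) (pr j).
    by rewrite prpr; apply: homotopic_refl.
  case: (idem (pr j) (cpr j) hprj) => [p0|p1].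
    by apply: (contr j _ _ p0); rewrite blockB block_sumproj eqxx block0 subr0.
  apply: (contr i _ _ (homotopic_sym p1));
    by rewrite blockB block_sumproj (negPf ij) block1 subr0.
move: m_gt0 all1; clear; case: m => [|[|m]] // _.
by move=> /(_ ord0 ord_max)/(congr1 val).
Qed.

Lemma label_bijection (P Q : proj n) :
  (forall i, #|[pred x : pidx P | plab x == i]| = #|[pred y : pidx Q | plab y == i]|) ->
  exists (s : pidx P -> pidx Q) (t : pidx Q -> pidx P),
    [/\ cancel s t, cancel t s & label_preserving s].
Proof.
move=> PQ.
pose fib (P : proj n) i := enum [pred x : pidx P | plab x == i].
have mem_fib (P' : proj n) (x : pidx P') : x \in fib P' (plab x).
  by rewrite mem_enum inE.
have size_fib i : size (fib P i) = size (fib Q i) by rewrite -!cardE PQ.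
(* The r-th element of a fibre goes to the r-th element of the fibre over the same label. The
   default [y0] of [nth] is never returned, the index being in range; [exQ] and [exP] merely supply
   one. *)
pose tr (P1 P2 : proj n) (x : pidx P1) (y0 : pidx P2) :=
  nth y0 (fib P2 (plab x)) (index x (fib P1 (plab x))).
have tr_lab P1 P2 (x : pidx P1) y0 :
    (forall i, size (fib P1 i) = size (fib P2 i)) -> plab (tr P1 P2 x y0) = plab x.
  move=> sz; have : tr P1 P2 x y0 \in fib P2 (plab x).
    by rewrite mem_nth // -sz index_mem mem_fib.
  by rewrite mem_enum inE => /eqP.
have trK P1 P2 (x : pidx P1) y0 x0 :
    (forall i, size (fib P1 i) = size (fib P2 i)) -> tr P2 P1 (tr P1 P2 x y0) x0 = x.
  move=> sz; rewrite {1}/tr tr_lab // {1}/tr index_uniq ?enum_uniq //.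
    by rewrite nth_index ?mem_fib.
  by rewrite -sz index_mem mem_fib.
have exQ (x : pidx P) : exists y : pidx Q, true.
  have : (0 < #|[pred y : pidx Q | plab y == plab x]|)%N.
    by rewrite -PQ; apply/card_gt0P; exists x; rewrite inE.
  by case/card_gt0P => y _; exists y.
have exP (y : pidx Q) : exists x : pidx P, true.
  have : (0 < #|[pred x : pidx P | plab x == plab y]|)%N.
    by rewrite PQ; apply/card_gt0P; exists y; rewrite inE.
  by case/card_gt0P => x _; exists x.
exists (fun x => tr P Q x (xchoose (exQ x))), (fun y => tr Q P y (xchoose (exP y))).
by split=> x; rewrite ?trK ?tr_lab.
Qed.

Lemma card_label_projOf (a : 'I_n -> nat) i :
  #|[pred x : pidx (projOf a) | plab x == i]| = a i.
Proof.
rewrite -sum1_card big_tagged (bigD1 i) //= [X in (_ + X)%N]big1 => [|j ji].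
  by rewrite addn0 (eq_bigl xpredT) ?sum1_card ?card_ord // => x; rewrite inE eqxx.
by rewrite big_pred0 // => x; rewrite inE; apply: negPf.
Qed.

Lemma card_label_psum m (P : 'I_m -> proj n) i :
  #|[pred x : pidx (psum P) | plab x == i]| =
  (\sum_j #|[pred x : pidx (P j) | plab x == i]|)%N.
Proof.
rewrite -sum1_card big_tagged.
by apply: eq_bigr => j _; rewrite sum1_card.
Qed.

End DirectSums.

(** * Polynomial functions and generic properties *)

Section PolynomialFunctions.
Variables (k : fieldType) (V : vectType k).
Implicit Types F G : V -> k.

(** [general] asks for a polynomial in the coordinates of an unspecified basis. Working with
    functions that admit such a polynomial spares writing it down. *)
Definition polyfun F :=
  exists p : {mpoly k[\dim {: V}]}, forall v, p.@[coords v] = F v.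

Lemma polyfun_linear F : (forall a u v, F (a *: u + v) = a * F u + F v) -> polyfun F.
Proof.
move=> linF; exists (\sum_(i < \dim {: V}) F (vbasis {: V})`_i *: 'X_i) => v.
have FD u w : F (u + w) = F u + F w by rewrite -[u]scale1r linF scale1r mul1r.
have F0 : F 0 = 0 by apply: (addrI (F 0)); rewrite -FD !addr0.
have FZ a u : F (a *: u) = a * F u by rewrite -[a *: u]addr0 linF F0 addr0.
rewrite [in RHS](coord_vbasis (memvf v)) (big_morph F FD F0) linear_sum /=.
by apply: eq_bigr => i _; rewrite mevalZ mevalXU FZ mulrC.
Qed.

Lemma polyfun_const c : polyfun (fun=> c).
Proof. by exists c%:MP => v; rewrite mevalC. Qed.

Lemma polyfunD F G : polyfun F -> polyfun G -> polyfun (fun v => F v + G v).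
Proof. by case=> p hp [q hq]; exists (p + q) => v; rewrite mevalD hp hq. Qed.

Lemma polyfunM F G : polyfun F -> polyfun G -> polyfun (fun v => F v * G v).
Proof. by case=> p hp [q hq]; exists (p * q) => v; rewrite mevalM hp hq. Qed.

Lemma polyfunN F : polyfun F -> polyfun (fun v => - F v).
Proof. by case=> p hp; exists (- p) => v; rewrite mevalN hp. Qed.

Lemma polyfun_sum (I : finType) (F : I -> V -> k) :
  (forall i, polyfun (F i)) -> polyfun (fun v => \sum_i F i v).
Proof.
move=> hF; elim: (index_enum I) => [|i s [p hp]].
  by exists 0 => v; rewrite big_nil meval0.
have [q hq] := hF i; exists (q + p) => v.
by rewrite big_cons mevalD hp hq.
Qed.

Lemma polyfun_prod (I : finType) (F : I -> V -> k) :
  (forall i, polyfun (F i)) -> polyfun (fun v => \prod_i F i v).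
Proof.
move=> hF; elim: (index_enum I) => [|i s [p hp]].
  by exists 1 => v; rewrite big_nil meval1.
have [q hq] := hF i; exists (q * p) => v.
by rewrite big_cons mevalM hp hq.
Qed.

Definition polymx m n (A : V -> 'M[k]_(m, n)) := forall i j, polyfun (fun v => A v i j).

Lemma eq_polyfun F G : F =1 G -> polyfun F -> polyfun G.
Proof. by move=> FG [p hp]; exists p => v; rewrite hp FG. Qed.

Lemma polyfun_det n (A : V -> 'M[k]_n) : polymx A -> polyfun (fun v => \det (A v)).
Proof.
move=> hA; apply: polyfun_sum => s; apply: polyfunM; first exact: polyfun_const.
exact: polyfun_prod.
Qed.

Lemma polymx_adj n (A : V -> 'M[k]_n) : polymx A -> polymx (fun v => \adj (A v)).
Proof.
move=> hA i j; apply: (@eq_polyfun (fun v => cofactor (A v) j i)) => [v|].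
  by rewrite mxE.
apply: polyfunM; first exact: polyfun_const.
apply: polyfun_det => i' j'.
by apply: eq_polyfun (hA (lift j i') (lift i j')) => v; rewrite !mxE.
Qed.

Lemma polymxM m n p (A : V -> 'M[k]_(m, n)) (A' : V -> 'M[k]_(n, p)) :
  polymx A -> polymx A' -> polymx (fun v => A v *m A' v).
Proof.
move=> hA hA' i j; apply: (@eq_polyfun (fun v => \sum_l A v i l * A' v l j)) => [v|].
  by rewrite mxE.
by apply: polyfun_sum => l; apply: polyfunM.
Qed.

Lemma polymxB m n (A A' : V -> 'M[k]_(m, n)) :
  polymx A -> polymx A' -> polymx (fun v => A v - A' v).
Proof.
move=> hA hA' i j; apply: (@eq_polyfun (fun v => A v i j - A' v i j)) => [v|].
  by rewrite !mxE.
by apply: polyfunD => //; apply: polyfunN.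
Qed.

End PolynomialFunctions.

Lemma coords_linear (k : fieldType) (V : vectType k) i a (u v : V) :
  coords (a *: u + v) i = a * coords u i + coords v i.
Proof. by rewrite /coords linearP. Qed.

(** The coordinates of [L v] are linear forms in v, and these are substituted into the polynomial.
    This is how open conditions pass between Hom spaces whose bases are unrelated. *)
Lemma polyfun_comp (k : fieldType) (V W : vectType k) (F : W -> k) (L : V -> W) :
  (forall a u v, L (a *: u + v) = a *: L u + L v) -> polyfun F -> polyfun (F \o L).
Proof.
move=> linL [p hp].
have coordL i : polyfun (fun v => coords (L v) i).
  by apply: polyfun_linear => a u v; rewrite linL coords_linear.
have /fin_all_exists [q hq] := coordL.
exists (p \mPo [tuple q i | i < \dim {: W}]) => v.
rewrite comp_mpoly_meval /= -hp; apply: meval_eq => i.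
by rewrite tnth_mktuple hq.
Qed.

Lemma mpoly_line (k : fieldType) m (p : {mpoly k[m]}) (u v : 'I_m -> k) :
  exists q : {poly k}, forall t, q.[t] = p.@[fun i => u i + t * v i].
Proof.
exists (\sum_(m <- msupp p) p@_m *: \prod_i ((u i)%:P + v i *: 'X) ^+ m i) => t.
rewrite mevalE horner_sum; apply: eq_bigr => w _.
rewrite hornerZ horner_prod; congr (_ * _); apply: eq_bigr => i _.
by rewrite horner_exp hornerD hornerC hornerZ hornerX mulrC.
Qed.

Section General.
Variables (k : fieldType) (B : falgType k) (n : nat) (e : 'I_n -> B).
Hypothesis ee : forall i, e i * e i = e i.
Local Notation Mor := (Mor B).

Lemma general_polyfun (P Q : proj n) (F : Mor P Q -> k) (Pr : Mor P Q -> Prop) :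
  polyfun F -> (exists2 f, isHom e f & F f != 0) ->
  (forall f, isHom e f -> F f != 0 -> Pr f) -> general e Pr.
Proof.
case=> p hp [f hf fn0] hPr; exists p; split; first by exists f; rewrite hp.
by move=> g hg; rewrite hp; apply: hPr.
Qed.

Lemma pullm_linear (P Q P' Q' : proj n) (s : pidx P' -> pidx P)
    (t : pidx Q' -> pidx Q) a (F G : Mor P Q) :
  pullm s t (a *: F + G) = a *: pullm s t F + pullm s t G.
Proof. by apply/ffunP => ij; rewrite !ffunE. Qed.

Lemma general_pullm (P Q P' Q' : proj n) (s : pidx P' -> pidx P) s'
    (t : pidx Q' -> pidx Q) t' (Pr' : Mor P' Q' -> Prop) (Pr : Mor P Q -> Prop) :
  cancel s s' -> cancel s' s -> cancel t t' -> cancel t' t ->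
  label_preserving s -> label_preserving t ->
  (forall f, isHom e f -> Pr' (pullm s t f) -> Pr f) ->
  general e Pr' -> general e Pr.
Proof.
move=> ss' s's tt' t't sl tl PrPr' [p [[f [hf pf]] hp]].
have sl' : label_preserving s' by move=> i; rewrite -sl s's.
have tl' : label_preserving t' by move=> i; rewrite -tl t't.
apply: (@general_polyfun _ _ ((fun g => p.@[coords g]) \o pullm s t)).
- by apply: polyfun_comp; [exact: pullm_linear | exists p].
- exists (pullm s' t' f); first exact: isHom_pullm.
  have -> // : ((fun g => p.@[coords g]) \o pullm s t) (pullm s' t' f) = p.@[coords f].
  by congr (p.@[coords _]); apply/ffunP => -[i j]; rewrite !ffunE /= ss' tt'.
- by move=> g hg /= pg; apply: PrPr' => //; apply: hp => //; apply: isHom_pullm.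
Qed.

End General.

(* On the line through a witness of each condition both polynomials are nonzero,
   and k is infinite. *)
Lemma general_meet (k : closedFieldType) (B : falgType k) n (e : 'I_n -> B)
    (P Q : proj n) (Pr1 Pr2 : Mor B P Q -> Prop) :
  general e Pr1 -> general e Pr2 -> exists f, [/\ isHom e f, Pr1 f & Pr2 f].
Proof.
move=> [p1 [[f1 [hf1 p1f1]] hp1]] [p2 [[f2 [hf2 p2f2]] hp2]].
pose g t := f1 + t *: (f2 - f1).
have [q1 hq1] := mpoly_line p1 (coords f1) (coords (f2 - f1)).
have [q2 hq2] := mpoly_line p2 (coords f1) (coords (f2 - f1)).
have cg t : coords (g t) =1 (fun i => coords f1 i + t * coords (f2 - f1) i).
  by move=> i; rewrite /g addrC coords_linear addrC.
have q1g t : q1.[t] = p1.@[coords (g t)] by rewrite hq1; apply: meval_eq => i; rewrite cg.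
have q2g t : q2.[t] = p2.@[coords (g t)] by rewrite hq2; apply: meval_eq => i; rewrite cg.
have g0 : g 0 = f1 by rewrite /g scale0r addr0.
have g1 : g 1 = f2 by rewrite /g scale1r addrC subrK.
have q1n0 : q1 != 0 by apply: contraNneq p1f1 => q0; rewrite -g0 -q1g q0 horner0.
have q2n0 : q2 != 0 by apply: contraNneq p2f2 => q0; rewrite -g1 -q2g q0 horner0.
have : q1 * q2 != 0 by rewrite mulf_neq0.
case/closed_nonrootP => t; rewrite rootM negb_or /root q1g q2g => /andP[p1g p2g].
have hg : isHom e (g t).
  by apply: isHomD => //; apply: isHomZ; apply: isHomD => //; apply: isHomN.
by exists (g t); split=> //; [apply: hp1 | apply: hp2].
Qed.

(** * Idempotents and uniqueness of canonical decompositions *)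

(** [l0], [l1], [l2] are the labels of P, Q, R in this order. *)
Definition l0 : 'I_3 := ord0.
Definition l1 : 'I_3 := @Ordinal 3 1 isT.
Definition l2 : 'I_3 := @Ordinal 3 2 isT.

Variant label_spec : 'I_3 -> Type :=
  | Label0 : label_spec l0 | Label1 : label_spec l1 | Label2 : label_spec l2.

Lemma labelP i : label_spec i.
Proof.
case: i => -[|[|[|//]]] i_lt; [have -> : Ordinal i_lt = l0 |
  have -> : Ordinal i_lt = l1 | have -> : Ordinal i_lt = l2]; try exact: val_inj;
  constructor.
Qed.

Section Idempotents.
Variable k : fieldType.
Notation B := (crossAlg k).
Implicit Types u v : B.

Lemma paD u v : pa (u + v) = pa u + pa v. Proof. by []. Qed.
Lemma pbD u v : pb (u + v) = pb u + pb v. Proof. by []. Qed.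
Lemma pcD u v : pc (u + v) = pc u + pc v. Proof. by []. Qed.
Lemma pxD u v : px (u + v) = px u + px v. Proof. by []. Qed.
Lemma pyD u v : py (u + v) = py u + py v. Proof. by []. Qed.
Lemma pzD u v : pz (u + v) = pz u + pz v. Proof. by []. Qed.

Lemma pa_sum (I : finType) (F : I -> B) : pa (\sum_i F i) = \sum_i pa (F i).
Proof. by rewrite (big_morph (@pa k) paD (erefl : pa 0 = 0 :> k)). Qed.
Lemma pb_sum (I : finType) (F : I -> B) : pb (\sum_i F i) = \sum_i pb (F i).
Proof. by rewrite (big_morph (@pb k) pbD (erefl : pb 0 = 0 :> k)). Qed.
Lemma pc_sum (I : finType) (F : I -> B) : pc (\sum_i F i) = \sum_i pc (F i).
Proof. by rewrite (big_morph (@pc k) pcD (erefl : pc 0 = 0 :> k)). Qed.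
Lemma px_sum (I : finType) (F : I -> B) : px (\sum_i F i) = \sum_i px (F i).
Proof. by rewrite (big_morph (@px k) pxD (erefl : px 0 = 0 :> 'rV[k]_3)). Qed.
Lemma py_sum (I : finType) (F : I -> B) : py (\sum_i F i) = \sum_i py (F i).
Proof. by rewrite (big_morph (@py k) pyD (erefl : py 0 = 0 :> 'rV[k]_3)). Qed.
Lemma pz_sum (I : finType) (F : I -> B) : pz (\sum_i F i) = \sum_i pz (F i).
Proof. by rewrite (big_morph (@pz k) pzD (erefl : pz 0 = 0 :> 'rV[k]_3)). Qed.

Lemma mulBE u v : u * v = mulB u v. Proof. by []. Qed.

Definition idem (i : 'I_3) : B :=
  mkB (i == l0)%:R (i == l1)%:R (i == l2)%:R 0 0 0.

(** The Peirce component of u, given as an explicit tuple: once the labels are concrete, an entry of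
    a morphism is displayed with its only possible coordinate. It is 0 for i > j, the algebra being
    upper triangular. *)
Definition corner (i j : 'I_3) u : B :=
  match nat_of_ord i, nat_of_ord j with
  | 0%N, 0%N => mkB (pa u) 0 0 0 0 0
  | 1%N, 1%N => mkB 0 (pb u) 0 0 0 0
  | 2%N, 2%N => mkB 0 0 (pc u) 0 0 0
  | 0%N, 1%N => mkB 0 0 0 (px u) 0 0
  | 1%N, 2%N => mkB 0 0 0 0 (py u) 0
  | 0%N, 2%N => mkB 0 0 0 0 0 (pz u)
  | _, _ => 0
  end.

Definition simpB := (mul0r, mulr0, mul1r, mulr1, scale0r, scaler0, scale1r,
  addr0, add0r, cross0l, cross0r).

Lemma idem_corner i j u : idem i * u * idem j = corner i j u.
Proof.
case: (labelP i); case: (labelP j); apply: crossAlgP; split;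
  rewrite !mulBE /mulB /idem /corner /pa /pb /pc /px /py /pz /= ?eqxx /=;
  by rewrite !simpB.
Qed.

Lemma idemM i : idem i * idem i = idem i.
Proof.
case: (labelP i); apply: crossAlgP; split;
  rewrite !mulBE /mulB /idem /pa /pb /pc /px /py /pz /= ?eqxx /=;
  by rewrite !simpB.
Qed.

Lemma idemMn i j : i != j -> idem i * idem j = 0.
Proof.
case: (labelP i); case: (labelP j) => // _; apply: crossAlgP; split;
  rewrite !mulBE /mulB /idem /pa /pb /pc /px /py /pz /= ?eqxx /=;
  by rewrite ?simpB.
Qed.

Lemma idem_neq0 i : idem i != 0.
Proof.
apply/eqP; case: (labelP i) => [/(congr1 (@pa k))|/(congr1 (@pb k))|/(congr1 (@pc k))] /eqP;
  by rewrite /idem /= /pa /pb /pc /= oner_eq0.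
Qed.

Lemma sum_idem : \sum_i idem i = 1.
Proof.
rewrite !big_ord_recl big_ord0; apply: crossAlgP; split;
  by rewrite /idem /pa /pb /pc /px /py /pz /= ?simpB.
Qed.

Lemma corner_diag i u : exists a : k, corner i i u = a *: idem i.
Proof.
case: (labelP i); [exists (pa u) | exists (pb u) | exists (pc u)];
  apply: crossAlgP; split; rewrite /corner /idem /pa /pb /pc /px /py /pz /=;
  rewrite ?scaler0 //; by rewrite /GRing.scale /= ?simpB.
Qed.

(** The quiver has no oriented cycles, so one of the two factors is already 0. *)
Lemma corner_mul0 i j u v : i != j -> corner i j u * corner j i v = 0.
Proof.
by case: (labelP i); case: (labelP j) => // _; rewrite /corner /= ?mul0r ?mulr0.
Qed.

Lemma local_idem i : localIdem (idem i).
Proof.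
split; [exact: idemM | exact: idem_neq0 | move=> x].
have [a xa] := corner_diag i x; rewrite idem_corner xa => ->.
have [->|a0] := eqVneq a 0.
  by right; exists (idem i); rewrite scale0r subr0 !idemM.
left; exists (a^-1 *: idem i).
have scaleM b c : (b *: idem i) * (c *: idem i) = (b * c) *: idem i.
  by rewrite -scalerAl -scalerAr idemM scalerA.
by rewrite !scaleM mulfV // mulVf // scale1r -scalerAr -scalerAl !idemM.
Qed.

Lemma isoIdem_idem i j : isoIdem (idem i) (idem j) -> i = j.
Proof.
case=> a [b [-> -> ab _]]; apply/eqP/negPn/negP => ij; move: ab.
by rewrite !idem_corner corner_mul0 1?eq_sym // => /esym/eqP; apply/negP/idem_neq0.
Qed.

Lemma complete_idem : completeIdems idem.
Proof.
split; [exact: local_idem | exact: isoIdem_idem | exists 3, idem].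
split; [exact: sum_idem | exact: idemMn | exact: local_idem |].
move=> i; exists i; exists (idem i), (idem i).
by rewrite !idemM.
Qed.

Lemma isHom_corner (P Q : proj 3) (F : Mor B P Q) q p :
  isHom idem F -> F (q, p) = corner (plab q) (plab p) (F (q, p)).
Proof. by move=> hF; rewrite -idem_corner {1}hF. Qed.

Lemma corner_isHom (P Q : proj 3) (F : Mor B P Q) :
  (forall q p, F (q, p) = corner (plab q) (plab p) (F (q, p))) -> isHom idem F.
Proof. by move=> hF [q p]; rewrite idem_corner -hF. Qed.

(** [P0 th] and [P1 th] share no label. A diagonal entry of f h or h f is therefore a sum of
    products going to another vertex and back, which are 0, whereas a contraction makes it an
    idempotent [idem i]. *)
Lemma contractible_K0 (th : K0 3) (f : HomT B th) : isHom idem f ->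
  homotopic idem (cmid idem (Pf f)) (cmzero (Pf f) (Pf f)) -> th = 0.
Proof.
move=> hf [h [hh [/= h0 h1]]]; apply/ffunP => i; rewrite [RHS]ffunE.
have fh0 (q : pidx (P0 th)) (p : pidx (P1 th)) : tag q != tag p ->
    f (q, p) * h (p, q) = 0.
  by move=> qp; rewrite (isHom_corner _ _ hf) (isHom_corner _ _ hh) corner_mul0.
have hf0 (q : pidx (P0 th)) (p : pidx (P1 th)) : tag q != tag p ->
    h (p, q) * f (q, p) = 0.
  by move=> qp; rewrite (isHom_corner _ _ hf) (isHom_corner _ _ hh) corner_mul0 // eq_sym.
have disj (q : pidx (P0 th)) (p : pidx (P1 th)) : tag q != tag p.
  case: q p => [i1 q] [i2 p] /=; apply/eqP => E.
  have q_gt0 : (0 < posp (th i1))%N by apply: leq_ltn_trans (ltn_ord q).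
  have : (0 < negp (th i2))%N by apply: leq_ltn_trans (ltn_ord p).
  by move: q_gt0; rewrite E /posp /negp; case: (th i2) => [[|m]|m].
apply/eqP/negPn/negP => thi.
have [thp|thp] := ltnP 0 (posp (th i)).
  pose q : pidx (P0 th) := Tagged (fun i => 'I_(posp (th i))) (Ordinal thp).
  have := congr1 (fun F : Mor B _ _ => F (q, q)) h0.
  rewrite compE !ffunE /= eqxx subr0 big1 => [/eqP|p _]; last exact: fh0.
  exact/negP/idem_neq0.
have thn : (0 < negp (th i))%N by move: thi thp; rewrite /posp /negp; case: (th i) => [[|m]|m].
pose p : pidx (P1 th) := Tagged (fun i => 'I_(negp (th i))) (Ordinal thn).
have := congr1 (fun F : Mor B _ _ => F (p, p)) h1.
rewrite compE !ffunE /= eqxx subr0 big1 => [/eqP|q _]; last exact: hf0.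
exact/negP/idem_neq0.
Qed.

Lemma indecT_neq0 (th : K0 3) : indecT idem th -> th <> 0.
Proof.
move=> [p [[f [hf pf]] hp]] th0; case: (hp f hf pf) => nz _; apply: nz.
exists 0; split; first exact: isHom0.
by split; apply/ffunP => -[[i [o o_lt]] ?]; exfalso; move: o_lt; rewrite th0 ffunE.
Qed.

End Idempotents.

(** Some f is generic for both conditions: [Pf f] is indecomposable and isomorphic to the direct
    sum. No summand is contractible because no indecomposable class is 0, hence there is only one
    summand. *)
Lemma candec_indecT (k : closedFieldType) (th : K0 3) m (ths : 'I_m -> K0 3) :
  indecT (@idem k) th -> candec (@idem k) th ths ->
  m = 1%N /\ forall j, ths j = th.
Proof.
move=> ind_th [th_sum ind_ths dec].
have [f [hf f_ind [fs [hfs f_iso]]]] := general_meet ind_th dec.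
have hsum : isHom (@idem k) (d (cxsum (fun j => Pf (fs j)))).
  by apply: isHom_blockdiag.
have m1 : m = 1%N.
  apply: (@cxsum_indecK _ _ _ (@idem k) (@idemM k) m (fun j => Pf (fs j))) => //.
    exact: (indecK_iso (@idemM k) _ _ f_iso).
  by move=> j /(contractible_K0 (hfs j)); apply: indecT_neq0.
subst m; split=> // j; apply/ffunP => i.
by rewrite th_sum big_ord1 (ord1 j).
Qed.

(** * Commuting and cross product equations for matrices *)

Section Matrices.
Variable k : fieldType.

Lemma ord2P (i : 'I_2) : i = 0 \/ i = 1.
Proof. by case: i => -[|[|//]] i_lt; [left | right]; apply: val_inj. Qed.

Lemma mx2P (A B : 'M[k]_2) :
  A 0 0 = B 0 0 -> A 0 1 = B 0 1 -> A 1 0 = B 1 0 -> A 1 1 = B 1 1 -> A = B.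
Proof.
by move=> *; apply/matrixP => i j; case: (ord2P i) => ->; case: (ord2P j) => ->.
Qed.

Lemma mulmx2E (A B : 'M[k]_2) i j : (A *m B) i j = A i 0 * B 0 j + A i 1 * B 1 j.
Proof.
by rewrite mxE big_ord_recl big_ord1; congr (_ + A i _ * B _ j); apply: val_inj.
Qed.

(** The pairs (ua, va) and (ub, vb) are the multiples of (u, v) by wa/w and wb/w, so their minor
    vanishes. *)
Lemma proportional_minor (w u v wa ua va wb ub vb : k) : w != 0 ->
  w * ua = u * wa -> w * va = v * wa -> w * ub = u * wb -> w * vb = v * wb ->
  ua * vb = va * ub.
Proof.
move=> w0 Ua Va Ub Vb; apply: (mulfI w0); apply: (mulfI w0).
have -> : w * (w * (ua * vb)) = (w * ua) * (w * vb) by ring.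
have -> : w * (w * (va * ub)) = (w * va) * (w * ub) by ring.
by rewrite Ua Va Ub Vb; ring.
Qed.

(* In 'M_2 the centraliser of a non-scalar matrix A is spanned by 1 and A, hence
   is commutative: modulo scalars, X and Y are both proportional to A. *)
Lemma commutator_scalar (A X Y : 'M[k]_2) :
  A *m X = X *m A -> A *m Y = Y *m A -> X *m Y != Y *m X -> is_scalar_mx A.
Proof.
(* Z commutes with A when the vector (Z01, Z10, Z11 - Z00) is parallel to the same vector of A; the
   three equations are the minors. *)
have rel (Z : 'M[k]_2) : A *m Z = Z *m A ->
    [/\ A 0 1 * Z 1 0 = Z 0 1 * A 1 0,
        A 0 1 * (Z 1 1 - Z 0 0) = Z 0 1 * (A 1 1 - A 0 0) &
        A 1 0 * (Z 1 1 - Z 0 0) = Z 1 0 * (A 1 1 - A 0 0)].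
  move=> /matrixP AZ; have := (AZ 0 0, AZ 0 1, AZ 1 0).
  rewrite !mulmx2E => -[[E00 E01] E10].
  split; apply/eqP; rewrite -subr_eq0; apply/eqP.
  - by move/eqP: E00; rewrite -subr_eq0 => /eqP <-; ring.
  - by move/eqP: E01; rewrite -subr_eq0 => /eqP <-; ring.
  - by move/eqP: E10; rewrite eq_sym -subr_eq0 => /eqP <-; ring.
move=> /rel[X1 X2 X3] /rel[Y1 Y2 Y3]; apply: contraNT => nsA; apply/eqP.
have [D1 D2 D3] : [/\ X 0 1 * Y 1 0 = Y 0 1 * X 1 0,
    X 0 1 * (Y 1 1 - Y 0 0) = Y 0 1 * (X 1 1 - X 0 0) &
    X 1 0 * (Y 1 1 - Y 0 0) = Y 1 0 * (X 1 1 - X 0 0)].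
  (* A nonzero coordinate of the vector of A serves as the pivot w in [proportional_minor]. If all
     three vanish, A is scalar. *)
  have [A01|A01] := eqVneq (A 0 1) 0; last first.
    pose minor := @proportional_minor (A 0 1) (X 0 1) (Y 0 1).
    split.
    - exact: (minor _ _ _ _ _ _ A01 (mulrC _ _) (mulrC _ _) X1 Y1).
    - exact: (minor _ _ _ _ _ _ A01 (mulrC _ _) (mulrC _ _) X2 Y2).
    - exact: (minor _ _ _ _ _ _ A01 X1 Y1 X2 Y2).
  have swap (a b c d : k) : a * b = c * d -> d * c = b * a.
    by rewrite (mulrC d) (mulrC b).
  have [A10|A10] := eqVneq (A 1 0) 0; last first.
    pose minor := @proportional_minor (A 1 0) (X 1 0) (Y 1 0).
    split.
    - exact: (minor _ _ _ _ _ _ A10 (swap _ _ _ _ X1) (swap _ _ _ _ Y1) (mulrC _ _) (mulrC _ _)).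
    - exact: (minor _ _ _ _ _ _ A10 (swap _ _ _ _ X1) (swap _ _ _ _ Y1) X3 Y3).
    - exact: (minor _ _ _ _ _ _ A10 (mulrC _ _) (mulrC _ _) X3 Y3).
  have [A11|A11] := eqVneq (A 1 1 - A 0 0) 0; last first.
    pose minor := @proportional_minor (A 1 1 - A 0 0) (X 1 1 - X 0 0) (Y 1 1 - Y 0 0).
    split.
    - exact: (minor _ _ _ _ _ _ A11 (swap _ _ _ _ X2) (swap _ _ _ _ Y2) (swap _ _ _ _ X3) (swap _ _ _ _ Y3)).
    - exact: (minor _ _ _ _ _ _ A11 (swap _ _ _ _ X2) (swap _ _ _ _ Y2) (mulrC _ _) (mulrC _ _)).
    - exact: (minor _ _ _ _ _ _ A11 (swap _ _ _ _ X3) (swap _ _ _ _ Y3) (mulrC _ _) (mulrC _ _)).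
  case/negP: nsA; apply/is_scalar_mxP; exists (A 0 0).
  apply: mx2P; rewrite !mxE /= ?mulr1n ?mulr0n //.
  by move/eqP: A11; rewrite subr_eq0 => /eqP.
apply: mx2P; rewrite !mulmx2E; apply/eqP; rewrite -subr_eq0; apply/eqP.
- by move/eqP: D1; rewrite -subr_eq0 => /eqP <-; ring.
- by move/eqP: D2; rewrite -subr_eq0 => /eqP <-; ring.
- by move/eqP: D3; rewrite eq_sym -subr_eq0 => /eqP <-; ring.
- by move/eqP: D1; rewrite eq_sym -subr_eq0 => /eqP <-; ring.
Qed.

Section Blowup.
Variable n : nat.
Implicit Types Y Z : 'I_3 -> 'M[k]_n.

(** For invertible Y_2 this is det Y_2 times Y_0 V Y_1 - Y_1 V Y_0 with V the inverse of Y_2; the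
    adjugate makes it polynomial in Y. It is identically 0 for n = 1, in accordance with [theta]
    being indecomposable. *)
Definition commutator Y :=
  Y l0 *m \adj (Y l2) *m Y l1 - Y l1 *m \adj (Y l2) *m Y l0.

Definition discriminant Y := \det (Y l2) * \det (commutator Y).

Lemma discriminant_unit Y : discriminant Y != 0 ->
  Y l2 \in unitmx /\
  Y l0 *m invmx (Y l2) *m Y l1 - Y l1 *m invmx (Y l2) *m Y l0 \in unitmx.
Proof.
rewrite mulf_eq0 negb_or => /andP[dY dW].
have uY : Y l2 \in unitmx by rewrite unitmxE unitfE.
split=> //; rewrite /invmx uY -!scalemxAr -!scalemxAl -scalerBr.
by rewrite unitmxZ ?unitfE ?invr_eq0 // unitmxE unitfE.
Qed.

(* Normalising Y_2 to 1, two of the three equations express X_0 and X_1 through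
   X_2, and the third one becomes X_2 (Y_0 Y_1 - Y_1 Y_0) = known. *)
Lemma cross_solvable Y Z : discriminant Y != 0 ->
  exists X : 'I_3 -> 'M[k]_n,
    [/\ X l1 *m Y l2 - X l2 *m Y l1 = Z l0,
        X l2 *m Y l0 - X l0 *m Y l2 = Z l1 &
        X l0 *m Y l1 - X l1 *m Y l0 = Z l2].
Proof.
move=> /discriminant_unit; set V := invmx (Y l2); set W := _ - _ => -[uY uW].
have VK M : M *m V *m Y l2 = M by rewrite mulmxKV.
pose X2 := (Z l2 + Z l1 *m V *m Y l1 + Z l0 *m V *m Y l0) *m invmx W.
have X2W : X2 *m W = Z l2 + Z l1 *m V *m Y l1 + Z l0 *m V *m Y l0.
  by rewrite mulmxKV.
exists (fun i => [:: (X2 *m Y l0 - Z l1) *m V; (Z l0 + X2 *m Y l1) *m V; X2]`_i).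
split; rewrite /= ?VK.
- by rewrite addrK.
- by rewrite opprB addrCA subrr addr0.
have rearrange (U : zmodType) (a b c d z : U) :
    a - b = z + c + d -> a - c - (d + b) = z.
  move/eqP; rewrite subr_eq => /eqP ->.
  by rewrite -(addrA (z + c)) (addrAC (z + c)) !addrK.
rewrite !mulmxBl !mulmxDl; apply: rearrange.
by rewrite -X2W /W mulmxBr !mulmxA.
Qed.
End Blowup.

(** C is the conjugate of A by Y_2, and A commutes with Y_0 V and Y_1 V, where V is the inverse of
    Y_2. These two do not commute, so A is scalar, and an idempotent scalar is 0 or 1. *)
Lemma commutator_idem (Y : 'I_3 -> 'M[k]_2) (A C : 'M[k]_2) :
  discriminant Y != 0 -> (forall i, A *m Y i = Y i *m C) -> A *m A = A ->
  (A = 0 /\ C = 0) \/ (A = 1%:M /\ C = 1%:M).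
Proof.
move=> /discriminant_unit; set V := invmx (Y l2) => -[uY uW] AYC AA.
have CE : C = V *m A *m Y l2 by rewrite -mulmxA AYC mulKmx.
have AYV i : A *m (Y i *m V) = (Y i *m V) *m A.
  by rewrite mulmxA AYC CE -!mulmxA mulmxV // mulmx1.
have : is_scalar_mx A.
  (* The commutator of Y_0 V and Y_1 V is the invertible matrix of [uW] times V, so it cannot
     vanish. *)
  apply: (commutator_scalar (AYV l0) (AYV l1)); apply: contraTneq uW => XY.
  have -> : Y l0 *m V *m Y l1 - Y l1 *m V *m Y l0 = 0.
    have uV : V \in unitmx by rewrite unitmx_inv.
    apply: (can_inj (mulmxK uV)); rewrite mul0mx mulmxBl.
    by rewrite -[Y l0 *m V *m Y l1 *m V]mulmxA XY mulmxA subrr.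
  by rewrite unitmxE det0 unitr0.
case/is_scalar_mxP => a Aa.
have : a * a == a.
  by have /matrixP/(_ 0 0) := AA; rewrite Aa -scalar_mxM !mxE eqxx !mulr1n => ->.
rewrite -subr_eq0 -[X in _ - X]mulr1 -mulrBr mulf_eq0 subr_eq0.
case/orP => /eqP a01; [left | right]; rewrite CE Aa a01.
  by rewrite raddf0 mulmx0 mul0mx.
by rewrite mulmx1 mulVmx.
Qed.
End Matrices.

(** * Model complexes *)

(** Models with plain indices: [cproj n l2] stands for n copies of R, and [tproj n] for n copies of
    P (indices [inl]) plus n copies of Q (indices [inr]). *)
Definition cproj n (l : 'I_3) : proj 3 := @Proj 3 'I_n (fun=> l).
Definition tproj n : proj 3 :=
  @Proj 3 ('I_n + 'I_n)%type (fun x => if x is inl _ then l0 else l1).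

Lemma card_label_cproj n l i :
  #|[pred x : pidx (cproj n l) | plab x == i]| = if l == i then n else 0%N.
Proof.
case: ifP => li; last by rewrite eq_card0 // => x; rewrite !inE.
by rewrite -[RHS]card_ord; apply: eq_card => x; rewrite !inE.
Qed.

Lemma card_label_tproj n i :
  #|[pred x : pidx (tproj n) | plab x == i]| =
  ((if l0 == i then n else 0) + (if l1 == i then n else 0))%N.
Proof.
rewrite -!card_label_cproj -!sum1_card big_sumType /=.
by congr (_ + _)%N; apply: eq_bigl => x; rewrite !inE.
Qed.

Section StandardComplexes.
Variable k : fieldType.
Notation B := (crossAlg k).
Notation idem := (@idem k).
Implicit Types u v : B.

(** All components of the homotopy are maps from P or Q to R, and those are 0. *)
Lemma homotopic_strict (X Y : cx B 3) (f g : chainMap X Y) :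
  (forall p : pidx (c1 Y), plab p = l2) ->
  (forall q : pidx (c0 X), plab q != l2) ->
  homotopic idem f g -> m0 f = m0 g /\ m1 f = m1 g.
Proof.
move=> lY lX [h [hh [h0 h1]]].
have hE : h = 0.
  apply/ffunP => -[p q]; rewrite ffunE (isHom_corner _ _ hh) lY.
  by have := lX q; case: (labelP (plab q)).
move: h0 h1; rewrite hE comp0l comp0r.
by move=> /eqP + /eqP; rewrite !subr_eq0 => /eqP-> /eqP->.
Qed.

Lemma homotopic_eq (X Y : cx B 3) (f g : chainMap X Y) :
  m0 f = m0 g -> m1 f = m1 g -> homotopic idem f g.
Proof.
case: f => f1 f0; case: g => g1 g0 /= -> ->; exact: homotopic_refl.
Qed.

Lemma eq_entry (P Q : proj 3) (F G : Mor B P Q) :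
  F = G -> forall q p, F (q, p) = G (q, p).
Proof. by move=> ->. Qed.

Definition ymx m n (f : 'I_m -> 'I_n -> B) (c : 'I_3) : 'M[k]_(m, n) :=
  \matrix_(i, j) py (f i j) 0 c.

Lemma pbM u v : pb (u * v) = pb u * pb v. Proof. by []. Qed.
Lemma pxM u v : px (u * v) = pa u *: px v + pb v *: px u. Proof. by []. Qed.
Lemma pyM u v : py (u * v) = pb u *: py v + pc v *: py u. Proof. by []. Qed.
Lemma pzM u v : pz (u * v) = pa u *: pz v + cross (px u) (py v) + pc v *: pz u.
Proof. by []. Qed.

(** An endomorphism is a pair of scalar matrices (A, C) with A Y_c = Y_c C for all c, as for
    representations of the quiver with three parallel arrows. *)
Lemma indecK_kronecker (F : Mor B (cproj 2 l2) (cproj 2 l1)) :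
  isHom idem F -> discriminant (ymx (fun i j => F (i, j))) != 0 ->
  indecK idem (Cx F).
Proof.
move=> hF disc.
have Fy i j : F (i, j) = mkB 0 0 0 0 (py (F (i, j))) 0 by apply: isHom_corner.
have strict (f g : chainMap (Cx F) (Cx F)) :
  homotopic idem f g -> m0 f = m0 g /\ m1 f = m1 g by apply: homotopic_strict.
split=> [/strict[/= /eq_entry/(_ ord0 ord0) + _]|f [h1 h0 /= fF] /strict[]].
  by rewrite !ffunE /= => /eqP; apply/negP/idem_neq0.
case: f h1 h0 fF => f1 f0 /= h1 h0 fF f00 f11.
pose A : 'M[k]_2 := \matrix_(i, j) pb (f0 (i, j)).
pose C : 'M[k]_2 := \matrix_(i, j) pc (f1 (i, j)).
have f0E i j : f0 (i, j) = mkB 0 (A i j) 0 0 0 0.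
  by rewrite mxE; apply: isHom_corner.
have f1E i j : f1 (i, j) = mkB 0 0 (C i j) 0 0 0.
  by rewrite mxE; apply: isHom_corner.
have AYC c : A *m ymx (fun i j => F (i, j)) c = ymx (fun i j => F (i, j)) c *m C.
  apply/matrixP => i j; have := congr1 (fun u : B => py u 0 c) (eq_entry fF i j).
  rewrite !compE !py_sum !summxE !mxE => E.
  transitivity (\sum_l py (f0 (i, l) * F (l, j)) 0 c).
    by apply: eq_bigr => l _; rewrite f0E Fy pyM !mxE /= /py /pc /=; ring.
  by rewrite E; apply: eq_bigr => l _; rewrite f1E Fy pyM !mxE /= /py /pb /pc /=; ring.
have AA : A *m A = A.
  apply/matrixP => i j; have := congr1 (@pb k) (eq_entry f00 i j).
  by rewrite compE pb_sum !mxE => <-; apply: eq_bigr => l _; rewrite !mxE.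
case: (commutator_idem disc AYC AA) => -[A01 C01]; [left | right];
  apply: homotopic_eq; apply/ffunP => -[i j] /=;
  rewrite ?f0E ?f1E ?A01 ?C01 !ffunE /= mxE //; by case: eqP.
Qed.

Lemma sum_label (V : nmodType) (F : 'I_3 -> V) : \sum_i F i = F l0 + F l1 + F l2.
Proof.
rewrite !big_ord_recl big_ord0 addr0 addrA.
by congr (_ + F _ + F _); apply: val_inj.
Qed.

Lemma crossE (x y : 'rV[k]_3) :
  [/\ cross x y 0 l0 = x 0 l1 * y 0 l2 - x 0 l2 * y 0 l1,
      cross x y 0 l1 = x 0 l2 * y 0 l0 - x 0 l0 * y 0 l2 &
      cross x y 0 l2 = x 0 l0 * y 0 l1 - x 0 l1 * y 0 l0].
Proof.
by split; rewrite mxE; congr (x _ _ * y _ _ - x _ _ * y _ _); apply: val_inj.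
Qed.

Definition dot (x y : 'rV[k]_3) : k := \sum_i x 0 i * y 0 i.

Lemma dot_cross (x y : 'rV[k]_3) : dot (cross x y) y = 0.
Proof. by rewrite /dot sum_label; case: (crossE x y) => -> -> ->; ring. Qed.

Lemma dotD (x x' y : 'rV[k]_3) : dot (x + x') y = dot x y + dot x' y.
Proof. by rewrite -big_split /=; apply: eq_bigr => i _; rewrite mxE mulrDl. Qed.

Lemma dotZ a (x y : 'rV[k]_3) : dot (a *: x) y = a * dot x y.
Proof. by rewrite mulr_sumr; apply: eq_bigr => i _; rewrite mxE mulrA. Qed.

Lemma dot0 (y : 'rV[k]_3) : dot 0 y = 0.
Proof. by rewrite /dot big1 // => i _; rewrite mxE mul0r. Qed.

Lemma dotC (x y : 'rV[k]_3) : dot x y = dot y x.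
Proof. by apply: eq_bigr => i _; rewrite mulrC. Qed.

Notation lt1 := (inl ord0 : pidx (tproj 1)).
Notation rt1 := (inr ord0 : pidx (tproj 1)).

Lemma sum_tproj1 (V : nmodType) (F : pidx (tproj 1) -> V) :
  \sum_q F q = F lt1 + F rt1.
Proof. by rewrite big_sumType !big_ord1. Qed.

(** An endomorphism consists of scalars a, b, c on P, Q, R and a vector x giving a map from Q to P.
    The hypothesis says that z is not of the form v x y, and it forces a = b = c. *)
Lemma indecK_wild (F : Mor B (cproj 1 l2) (tproj 1)) :
  isHom idem F ->
  dot (pz (F (lt1, ord0))) (py (F (rt1, ord0))) != 0 -> indecK idem (Cx F).
Proof.
move=> hF; set z := pz _; set y := py _ => zy.
have y0 : y != 0 by apply: contraNneq zy => ->; rewrite dotC dot0.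
have Fl : F (lt1, ord0) = mkB 0 0 0 0 0 z by apply: isHom_corner.
have Fr : F (rt1, ord0) = mkB 0 0 0 0 y 0 by apply: isHom_corner.
have strict (f g : chainMap (Cx F) (Cx F)) :
    homotopic idem f g -> m0 f = m0 g /\ m1 f = m1 g.
  by apply: homotopic_strict => // -[].
split=> [/strict[_ /= /eq_entry/(_ ord0 ord0)]|f [h1 h0 /= fF] /strict[]].
  by rewrite !ffunE /= => /eqP; apply/negP/idem_neq0.
case: f h1 h0 fF => f1 f0 /= h1 h0 fF f00 _.
set a := pa (f0 (lt1, lt1)); set b := pb (f0 (rt1, rt1)).
set x := px (f0 (lt1, rt1)); set c := pc (f1 (ord0, ord0)).
have f0ll : f0 (lt1, lt1) = mkB a 0 0 0 0 0 by apply: isHom_corner.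
have f0lr : f0 (lt1, rt1) = mkB 0 0 0 x 0 0 by apply: isHom_corner.
have f0rl : f0 (rt1, lt1) = 0 by apply: isHom_corner.
have f0rr : f0 (rt1, rt1) = mkB 0 b 0 0 0 0 by apply: isHom_corner.
have f1E : f1 (ord0, ord0) = mkB 0 0 c 0 0 0 by apply: isHom_corner.
have by_cy : b *: y = c *: y.
  have := congr1 (@py k) (eq_entry fF rt1 ord0).
  rewrite !compE sum_tproj1 big_ord1 f0rl f0rr f1E Fl Fr mul0r add0r !pyM.
  by rewrite /mkB /pb /py /pc /= !simpB.
have az_cz : a *: z + cross x y = c *: z.
  have := congr1 (@pz k) (eq_entry fF lt1 ord0).
  rewrite !compE sum_tproj1 big_ord1 f0ll f0lr f1E Fl Fr pzD !pzM.
  by rewrite /mkB /pa /px /py /pz /pc /= !simpB.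
have bc : b = c.
  apply/eqP; rewrite -subr_eq0; move/eqP: by_cy.
  by rewrite -subr_eq0 -scalerBl scaler_eq0 (negPf y0) orbF.
(* Pairing with y removes the term [cross x y]. *)
have ac : a = c.
  apply: (mulIf zy); rewrite -!dotZ -az_cz dotD dot_cross addr0 //.
have bb : b * b = b.
  have := congr1 (@pb k) (eq_entry f00 rt1 rt1).
  by rewrite compE sum_tproj1 f0rl f0rr mul0r add0r pbM.
have xx : a *: x + b *: x = x.
  have := congr1 (@px k) (eq_entry f00 lt1 rt1).
  rewrite compE sum_tproj1 f0ll f0lr f0rr pxD !pxM.
  by rewrite /mkB /pa /pb /px /= !simpB.
(* Idempotency gives x = 2bx with b equal to 0 or 1; both cases yield x = 0, in every
   characteristic. *)
have x0 : x = 0.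
  have /eqP : b * b - b = 0 by rewrite bb subrr.
  rewrite -[X in _ - X]mulr1 -mulrBr mulf_eq0 subr_eq0 => /orP[] /eqP b01.
    by rewrite -xx ac -bc b01 !scale0r addr0.
  by apply: (addrI x); rewrite addr0 -[in RHS]xx ac -bc b01 !scale1r.
have /eqP : b * b - b = 0 by rewrite bb subrr.
rewrite -[X in _ - X]mulr1 -mulrBr mulf_eq0 subr_eq0.
case/orP => /eqP b01; [left | right]; apply: homotopic_eq; apply/ffunP => -[i j] /=.
- case: i => i; case: j => j; rewrite !ord1 ?f0ll ?f0lr ?f0rl ?f0rr ?x0 ?ac -?bc ?b01;
  by rewrite !ffunE.
- by rewrite !ord1 f1E -bc b01 ffunE.
- case: i => i; case: j => j; rewrite !ord1 ?f0ll ?f0lr ?f0rl ?f0rr ?x0 ?ac -?bc ?b01;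
  by rewrite !ffunE.
- by rewrite !ord1 f1E -bc b01 ffunE.
Qed.

Lemma indecK_point (F : Mor B (cproj 0 l2) (cproj 1 l0)) : indecK idem (Cx F).
Proof.
have no_idx (V : Type) (i : 'I_0) : V by case: i.
split=> [[h [_ [/= E _]]]|[f1 f0] [_ /= h0 _]].
  have := @eq_entry (cproj 1 l0) (cproj 1 l0) _ _ E ord0 ord0.
  rewrite compE !ffunE /= subr0 big_ord0 => /eqP; apply/negP/idem_neq0.
case=> h [_ [/= E _]].
have := @eq_entry (cproj 1 l0) (cproj 1 l0) _ _ E ord0 ord0.
set a := pa (f0 (ord0, ord0)).
have f0E : f0 (ord0, ord0) = mkB a 0 0 0 0 0 by apply: isHom_corner.
rewrite compE !ffunE /= big_ord0 big_ord1 => /(congr1 (@pa k)) aa.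
have /eqP : a * a - a = 0 by exact: aa.
rewrite -[X in _ - X]mulr1 -mulrBr mulf_eq0 subr_eq0.
case/orP => /eqP a01; [left | right]; apply: homotopic_eq; apply/ffunP => -[i j] /=;
  try exact: no_idx; rewrite !ord1 f0E a01 !ffunE //.
Qed.

(** * Splitting off the copies of P *)

Section Split.
Variable n : nat.
Implicit Types F : Mor B (cproj n l2) (tproj n).

(** With the rows of P set to 0, each copy of P becomes a direct summand in degree 0. *)
Definition forget F : Mor B (cproj n l2) (tproj n) :=
  [ffun ij => if ij.1 is inl _ then 0 else F ij].

Lemma isHom_forget F : isHom idem F -> isHom idem (forget F).
Proof.
move=> hF; apply: corner_isHom => -[i|i] j; rewrite ffunE //=.
exact: (@isHom_corner k (cproj n l2) (tproj n) F (inr i) j hF).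
Qed.

(** A map from the copies of Q to the copies of P. Its square is 0, so 1 + [shear X] is an
    automorphism with inverse 1 - [shear X]. *)
Definition shear (X : 'I_3 -> 'M[k]_n) : Mor B (tproj n) (tproj n) :=
  [ffun ij => match ij.1, ij.2 with
    | inl i, inr j => mkB 0 0 0 (\row_c X c i j) 0 0
    | _, _ => 0
    end].

Lemma isHom_shear X : isHom idem (shear X).
Proof. by apply: corner_isHom => -[i|i] [j|j]; rewrite ffunE. Qed.

Lemma shear_shear X : Defs.comp (shear X) (shear X) = 0.
Proof.
apply/ffunP => -[i j]; rewrite compE [RHS]ffunE big1 // => -[l|l] _;
  rewrite !ffunE /=; first by case: i => i; rewrite mul0r.
by rewrite mulr0.
Qed.

Lemma shear_forget X F : Defs.comp (shear X) (forget F) = Defs.comp (shear X) F.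
Proof.
apply/ffunP => -[i j]; rewrite !compE; apply: eq_bigr => -[l|l] _;
  rewrite !ffunE //=; by case: i => i; rewrite !mul0r.
Qed.

Lemma sum_mkBz (I : finType) (z : I -> 'rV[k]_3) :
  \sum_i mkB 0 0 0 0 0 (z i) = mkB 0 0 0 0 0 (\sum_i z i).
Proof.
by apply: crossAlgP; split;
  rewrite ?pa_sum ?pb_sum ?pc_sum ?px_sum ?py_sum ?pz_sum // big1.
Qed.

Lemma mkB_xy (x y : 'rV[k]_3) :
  mkB 0 0 0 x 0 0 * mkB 0 0 0 0 y 0 = mkB 0 0 0 0 0 (cross x y).
Proof.
by apply: crossAlgP; split; rewrite mulBE /mulB /pa /pb /pc /px /py /pz /= ?simpB.
Qed.

Lemma shear_comp F : isHom idem F ->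
  discriminant (ymx (fun i j => F (inr i, j))) != 0 ->
  exists X, Defs.comp (shear X) F = forget F - F.
Proof.
move=> hF disc.
(* The sign is that of [forget F - F]: the products x × y added to the rows of P have to cancel
   z. *)
pose Z c : 'M[k]_n := \matrix_(i, j) - pz (F (inl i, j)) 0 c.
have [X [X0 X1 X2]] := cross_solvable Z disc; exists X.
have Fl i j : F (inl i, j) = mkB 0 0 0 0 0 (pz (F (inl i, j))) by apply: isHom_corner.
have Fr i j : F (inr i, j) = mkB 0 0 0 0 (py (F (inr i, j))) 0 by apply: isHom_corner.
have shearl i j : shear X (i, inl j) = 0 by rewrite ffunE /=; case: i.
have shearr i j : shear X (inl i, inr j) = mkB 0 0 0 (\row_c X c i j) 0 0.
  by rewrite ffunE.
have shear0 i j : shear X (inr i, j) = 0 by rewrite ffunE.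
apply/ffunP => -[[i|i] j]; rewrite compE big_sumType /=; last first.
  by rewrite !big1 ?addr0 ?ffunE /= ?ffunE ?subrr // => l _; rewrite shear0 mul0r.
rewrite big1 ?add0r => [|l _]; last by rewrite shearl mul0r.
under eq_bigr do rewrite shearr Fr mkB_xy.
rewrite sum_mkBz ffunE [in RHS]ffunE /= ffunE Fl.
apply: crossAlgP; split; rewrite /mkB /pa /pb /pc /px /py /pz /= ?subrr ?oppr0 ?add0r //.
apply/rowP => c; rewrite summxE mxE.
have entry (M N : 'M[k]_n) : M = N -> M i j = N i j by move=> ->.
case: (labelP c).
- have := entry _ _ X0; rewrite !mxE => <-; rewrite -sumrB; apply: eq_bigr => l _.
  by case: (crossE (\row_c X c i l) (py (F (inr l, j)))) => -> _ _; rewrite !mxE.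
- have := entry _ _ X1; rewrite !mxE => <-; rewrite -sumrB; apply: eq_bigr => l _.
  by case: (crossE (\row_c X c i l) (py (F (inr l, j)))) => _ -> _; rewrite !mxE.
- have := entry _ _ X2; rewrite !mxE => <-; rewrite -sumrB; apply: eq_bigr => l _.
  by case: (crossE (\row_c X c i l) (py (F (inr l, j)))) => _ _ ->; rewrite !mxE.
Qed.

Lemma isoK_forget F : isHom idem F ->
  discriminant (ymx (fun i j => F (inr i, j))) != 0 ->
  isoK idem (Cx F) (Cx (forget F)).
Proof.
move=> hF disc; have [X XF] := shear_comp hF disc.
have h1 := isHom_idm (@idemM k) (P := tproj n).
have h1' := isHom_idm (@idemM k) (P := cproj n l2).
have hX := isHom_shear X; have hN := isHomN hX.
have hG := isHom_forget hF.
have NN : Defs.comp (shear X) (shear X) = 0 := shear_shear X.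
apply: (@isoK_strict _ _ _ _ (Cx F) (Cx (forget F))
  (@ChainMap _ _ _ (Cx F) (Cx (forget F)) (idm idem _) (idm idem _ + shear X))
  (@ChainMap _ _ _ (Cx (forget F)) (Cx F) (idm idem _) (idm idem _ - shear X))).
- split; [exact: h1' | exact: isHomD | rewrite /=].
  by rewrite compDl (comp_idl (@idemM k) hF) (comp_idr (@idemM k) hG) XF addrC subrK.
- split; [exact: h1' | exact: isHomD | rewrite /=].
  rewrite compDl compNl (comp_idl (@idemM k) hG) (comp_idr (@idemM k) hF).
  by rewrite shear_forget XF opprB addrC subrK.
- rewrite /cmcomp /cmid /=; congr ChainMap; first by rewrite (comp_idl (@idemM k) h1').
  rewrite compDl !compDr !compNl (comp_idl (@idemM k) h1) (comp_idl (@idemM k) hX).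
  by rewrite NN oppr0 addr0 (comp_idr (@idemM k) hX) addrK.
- rewrite /cmcomp /cmid /=; congr ChainMap; first by rewrite (comp_idl (@idemM k) h1').
  rewrite compDl !compDr !compNr (comp_idl (@idemM k) h1) (comp_idl (@idemM k) hX).
  rewrite NN oppr0 addr0 (comp_idr (@idemM k) hX).
  by rewrite subrK.
Qed.

End Split.
End StandardComplexes.

(** * Transfer from models to [Pf f], and a criterion for wildness *)

Section Transfer.
Variables (k : fieldType) (B : falgType k) (n : nat) (e : 'I_n -> B).
Hypothesis ee : forall i, e i * e i = e i.
Local Notation Mor := (Mor B).

Lemma general_HomT (th : K0 n) (P Q : proj n) (Pr' : Mor P Q -> Prop)
    (Pr : HomT B th -> Prop) :
  (forall i, #|[pred x : pidx P | plab x == i]| = negp (th i)) ->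
  (forall i, #|[pred x : pidx Q | plab x == i]| = posp (th i)) ->
  (forall f F, isHom e f -> isHom e F -> isoK e (Pf f) (Cx F) -> Pr' F -> Pr f) ->
  general e Pr' -> general e Pr.
Proof.
move=> cP cQ PrPr'.
have [i|s [s' [ss' s's sl]]] := @label_bijection n P (P1 th).
  by rewrite cP card_label_projOf.
have [i|t [t' [tt' t't tl]]] := @label_bijection n Q (P0 th).
  by rewrite cQ card_label_projOf.
apply: (general_pullm ss' s's tt' t't sl tl) => f hf.
apply: PrPr' => //; first exact: isHom_pullm.
exact/isoK_sym/(pullm_isoK ee ss' s's tt' t't sl tl hf).
Qed.

Lemma indecT_transfer (th : K0 n) (P Q : proj n) :
  (forall i, #|[pred x : pidx P | plab x == i]| = negp (th i)) ->
  (forall i, #|[pred x : pidx Q | plab x == i]| = posp (th i)) ->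
  general e (fun F : Mor P Q => indecK e (Cx F)) -> indecT e th.
Proof.
move=> cP cQ; apply: general_HomT => // f F hf hF fF.
by apply: indecK_iso => //; apply: isoK_sym.
Qed.

Lemma span_ind (V : vectType k) (X : seq V) (Pr : V -> Prop) :
  Pr 0 -> (forall a u v, Pr u -> Pr v -> Pr (a *: u + v)) ->
  (forall x, x \in X -> Pr x) -> forall v, v \in <<X>>%VS -> Pr v.
Proof.
move=> Pr0 PrL PrX v /(coord_span (X := in_tuple X)) ->.
apply: (big_ind Pr) => // [u w Pu Pw|i _]; first by rewrite -[u]scale1r; apply: PrL.
by rewrite -[_ *: _]addr0; apply: PrL => //; apply/PrX/mem_nth.
Qed.

Lemma isHom_prjHom (P Q : proj n) (F : Mor P Q) : isHom e (prjHom e F).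
Proof. by move=> ij; rewrite !ffunE !mulrA ee -!mulrA ee. Qed.

Lemma memv_homsp (P Q : proj n) (F : Mor P Q) :
  isHom e F <-> F \in homsp e P Q.
Proof.
split=> [hF|].
  have -> : F = \sum_i coord (vbasis {: Mor P Q}) i F *:
      prjHom e (vbasis {: Mor P Q})`_i.
    apply/ffunP => ij; rewrite hF sum_ffunE.
    rewrite {1}(coord_vbasis (memvf F)) sum_ffunE mulr_sumr mulr_suml.
    by apply: eq_bigr => i _; rewrite !ffunE -scalerAr -scalerAl.
  apply: memv_suml => i _; apply/memvZ/memv_span/map_f.
  by rewrite mem_nth ?size_tuple.
apply: span_ind => [|a u v hu hv|G /mapP[v _ ->]]; first exact: isHom0.
  by apply: isHomD => //; apply: isHomZ.
exact: isHom_prjHom.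
Qed.

(** The linear form l vanishes on all h f and g h but not on w, so these maps span a proper
    subspace. *)
Lemma dimHomShift_neq0 (th : K0 n) (f g w : HomT B th) (l : HomT B th -> k) :
  isHom e f -> isHom e g -> isHom e w ->
  (forall a u v, l (a *: u + v) = a * l u + l v) ->
  (forall h, isHom e h -> l (Defs.comp h f) = 0) ->
  (forall h, isHom e h -> l (Defs.comp g h) = 0) ->
  l w != 0 -> dimHomShift e f g <> 0%N.
Proof.
move=> hf hg hw linl lf lg lw.
have l0 : l 0 = 0.
  have l00 : l 0 = l 0 + l 0 by rewrite -{1}[0](addr0 0) -{1}[0](scale1r 0) linl mul1r.
  by apply: (addrI (l 0)); rewrite addr0 -l00.
pose Pr (v : HomT B th) := isHom e v /\ l v = 0.
have Pr0 : Pr 0 by split=> //; apply: isHom0.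
have PrL a u v : Pr u -> Pr v -> Pr (a *: u + v).
  move=> [hu lu] [hv lv]; split; last by rewrite linl lu lv mulr0 addr0.
  by apply: isHomD => //; apply: isHomZ.
have PrS v : v \in homsp_htp e f g -> Pr v.
  move=> /memv_addP[v1 hv1 [v2 hv2 ->]]; rewrite -[v1]scale1r.
  apply: (PrL).
    apply: (span_ind Pr0 PrL _ hv1) => _ /mapP[h /vbasis_mem/memv_homsp hh ->].
    by split; [apply: isHom_comp | apply: lf].
  apply: (span_ind Pr0 PrL _ hv2) => _ /mapP[h /vbasis_mem/memv_homsp hh ->].
  by split; [apply: isHom_comp | apply: lg].
(* Truncated subtraction yields only an inequality of dimensions; the inclusion of the subspaces
   turns it into equality. *)
move=> /eqP; rewrite subn_eq0 => dim_le.
have sub : (homsp_htp e f g <= homsp e (P1 th) (P0 th))%VS.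
  by apply/subvP => v /PrS[hv _]; apply/memv_homsp.
have /eqP E : homsp_htp e f g == homsp e (P1 th) (P0 th) by rewrite eqEdim sub.
have /PrS[_ lw0] : w \in homsp_htp e f g by rewrite E; apply/memv_homsp.
by rewrite lw0 eqxx in lw.
Qed.

End Transfer.

(** * The element theta *)

Section Example.
Variable k : fieldType.
Notation B := (crossAlg k).
Notation idem := (@idem k).

Definition theta : K0 3 := [ffun i : 'I_3 => nth 0 [:: 1; 1; -1] i].
Definition theta2 : K0 3 := [ffun i => theta i *+ 2].
Definition kronecker : K0 3 := [ffun i : 'I_3 => nth 0 [:: 0; 2%:Z; - 2%:Z] i].
Definition point : K0 3 := [ffun i : 'I_3 => nth 0 [:: 1; 0; 0] i].

Lemma polyfun_py (P Q : proj 3) ij c : polyfun (fun F : Mor B P Q => py (F ij) 0 c).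
Proof. by apply: polyfun_linear => a u v; rewrite !ffunE pyD !mxE. Qed.

Lemma polyfun_pz (P Q : proj 3) ij c : polyfun (fun F : Mor B P Q => pz (F ij) 0 c).
Proof. by apply: polyfun_linear => a u v; rewrite !ffunE pzD !mxE. Qed.

Lemma polyfun_discriminant (V : vectType k) n (Y : V -> 'I_3 -> 'M[k]_n) :
  (forall c, polymx (fun v => Y v c)) -> polyfun (fun v => discriminant (Y v)).
Proof.
move=> hY; apply: polyfunM; apply: polyfun_det => //.
by apply: polymxB; apply: polymxM => //; apply: polymxM => //; apply: polymx_adj.
Qed.

(** The commutator of the first two matrices is diag(1, -1), whose square is 1, so the discriminant
    is nonzero in every characteristic. *)
Definition unitY (c : 'I_3) : 'M[k]_2 :=
  nth 1%:M [:: delta_mx 0 1; delta_mx 1 0; 1%:M] c.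

Lemma discriminant_unitY (f : 'I_2 -> 'I_2 -> B) :
  (forall i j, py (f i j) = \row_c unitY c i j) -> discriminant (ymx f) != 0.
Proof.
move=> fY; have yE c : ymx f c = unitY c by apply/matrixP => i j; rewrite mxE fY mxE.
rewrite /discriminant /commutator !yE /unitY /= det1 mul1r.
have -> : \adj 1%:M = 1%:M :> 'M[k]_2 by rewrite -[LHS]mul1mx mul_mx_adj det1.
rewrite !mulmx1 !mul_delta_mx; set D := _ - _.
have DD : D *m D = 1%:M.
  by apply: mx2P; rewrite mulmx2E !mxE /= ?mulr1n ?mulr0n; ring.
apply: contraTneq (oner_neq0 k) => D0.
by rewrite -(det1 k 2) -DD det_mulmx D0 mul0r eqxx.
Qed.

Lemma indecT_theta : indecT idem theta.
Proof.
apply: (@indecT_transfer _ _ _ _ (@idemM k) _ (cproj 1 l2) (tproj 1)) => [i|i|].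
- by rewrite card_label_cproj ffunE; case: (labelP i).
- by rewrite card_label_tproj ffunE; case: (labelP i).
apply: (@general_polyfun _ _ _ _ _ _ (fun F : Mor B (cproj 1 l2) (tproj 1) =>
  dot (pz (F (inl ord0, ord0))) (py (F (inr ord0, ord0))))).
- by apply: polyfun_sum => c; apply: polyfunM; [exact: polyfun_pz | exact: polyfun_py].
(* Taking z = y = the first basis vector makes the scalar product 1. *)
- pose y : 'rV[k]_3 := delta_mx 0 l0.
  exists [ffun ij : pidx (tproj 1) * pidx (cproj 1 l2) =>
    if ij.1 is inl _ then mkB 0 0 0 0 0 y else mkB 0 0 0 0 y 0].
    by apply: corner_isHom => -[i|i] j; rewrite ffunE.
  rewrite !ffunE /= /dot sum_label !mxE /= mulr1 mulr0 !addr0; exact: oner_neq0.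
- by move=> F hF; apply: indecK_wild.
Qed.

Lemma indecT_kronecker : indecT idem kronecker.
Proof.
apply: (@indecT_transfer _ _ _ _ (@idemM k) _ (cproj 2 l2) (cproj 2 l1)) => [i|i|].
- by rewrite card_label_cproj ffunE; case: (labelP i).
- by rewrite card_label_cproj ffunE; case: (labelP i).
apply: (@general_polyfun _ _ _ _ _ _ (fun F : Mor B (cproj 2 l2) (cproj 2 l1) =>
  discriminant (ymx (fun i j => F (i, j))))).
- apply: polyfun_discriminant => c i j.
  by apply: (eq_polyfun _ (@polyfun_py (cproj 2 l2) (cproj 2 l1) (i, j) c)) => F; rewrite mxE.
- exists [ffun ij : pidx (cproj 2 l1) * pidx (cproj 2 l2) =>
    mkB 0 0 0 0 (\row_c unitY c ij.1 ij.2) 0].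
    by apply: corner_isHom => i j; rewrite ffunE.
  by apply: discriminant_unitY => i j; rewrite ffunE.
- by move=> F hF; apply: indecK_kronecker.
Qed.

Lemma indecT_point : indecT idem point.
Proof.
apply: (@indecT_transfer _ _ _ _ (@idemM k) _ (cproj 0 l2) (cproj 1 l0)) => [i|i|].
- by rewrite card_label_cproj ffunE; case: (labelP i).
- by rewrite card_label_cproj ffunE; case: (labelP i).
apply: (@general_polyfun _ _ _ _ _ _ (fun=> 1)); first exact: polyfun_const.
  by exists 0; [exact: isHom0 | exact: oner_neq0].
by move=> F _ _; apply: indecK_point.
Qed.

Definition summands (j : 'I_3) : K0 3 := if j == l0 then kronecker else point.

Lemma theta2_sum i : theta2 i = \sum_j summands j i.
Proof. by rewrite sum_label /summands !ffunE; case: (labelP i). Qed.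

Lemma indecT_summands j : indecT idem (summands j).
Proof.
by rewrite /summands; case: eqP => _; [exact: indecT_kronecker | exact: indecT_point].
Qed.

Lemma isoK_summands (F : Mor B (cproj 2 l2) (tproj 2)) : isHom idem F ->
  discriminant (ymx (fun i j => F (inr i, j))) != 0 ->
  exists fs : forall j, HomT B (summands j),
    (forall j, isHom idem (fs j)) /\ isoK idem (Cx F) (cxsum (fun j => Pf (fs j))).
Proof.
move=> hF disc.
have [i|s [s' [ss' s's sl]]] :=
    @label_bijection 3 (cproj 2 l2) (psum (fun j => P1 (summands j))).
  rewrite card_label_cproj card_label_psum sum_label !card_label_projOf /summands /=.
  by rewrite !ffunE; case: (labelP i).
have [i|t [t' [tt' t't tl]]] :=
    @label_bijection 3 (tproj 2) (psum (fun j => P0 (summands j))).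
  rewrite card_label_tproj card_label_psum sum_label !card_label_projOf /summands /=.
  by rewrite !ffunE; case: (labelP i).
have sl' : label_preserving s' by move=> i; rewrite -sl s's.
have tl' : label_preserving t' by move=> i; rewrite -tl t't.
have hG := isHom_forget hF.
have hG' := isHom_pullm sl' tl' hG.
pose fs j : HomT B (summands j) := block j (pullm s' t' (forget F)).
have hfs j : isHom idem (fs j) by apply: isHom_block.
exists fs; split=> //.
(* Nonzero entries of [forget F] have a row in Q and a column in R. Every R, hence every such
   column, lies in the summand [l0], while the rows outside it belong to P; so the off-diagonal
   blocks vanish. *)
have E : blockdiag fs = pullm s' t' (forget F).
  apply: blockP => [a b ab|j]; last first.
    by apply/ffunP => -[q p]; rewrite blockE blockdiagE.
  rewrite blockdiag_neq // !ffunE /=.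
  have tagb : tag b = l0.
    case: b {ab} => j [i o] /=; apply/eqP/negPn/negP => jl0; move: (leq_ltn_trans (leq0n o) (ltn_ord o)).
    by rewrite /summands (negPf jl0) ffunE; case: (labelP i).
  have laba : plab (t' a) = l0.
    rewrite tl'; case: a ab => j [i o] /=; rewrite tagb => jl0; move: (leq_ltn_trans (leq0n o) (ltn_ord o)).
    by rewrite /summands (negPf jl0) ffunE; case: (labelP i).
  by case: (t' a) laba.
apply: (@isoK_trans _ _ _ _ (@idemM k) _ (Cx (forget F))) => //.
- exact: isHom_blockdiag.
- exact: isoK_forget.
have -> : cxsum (fun j => Pf (fs j)) = Cx (pullm s' t' (forget F)).
  by rewrite -E.
exact/isoK_sym/(pullm_isoK (@idemM k) s's ss' t't tt' sl' tl' hG).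
Qed.

Lemma candec_theta2 : candec idem theta2 summands.
Proof.
split; [exact: theta2_sum | exact: indecT_summands |].
apply: (@general_HomT _ _ _ _ (@idemM k) _ (cproj 2 l2) (tproj 2)
  (fun F => discriminant (ymx (fun i j => F (inr i, j))) != 0)) => [i|i|f F hf hF fF disc|].
- by rewrite card_label_cproj !ffunE; case: (labelP i).
- by rewrite card_label_tproj !ffunE; case: (labelP i).
- have [fs [hfs Ffs]] := isoK_summands hF disc; exists fs; split=> //.
  apply: (@isoK_trans _ _ _ _ (@idemM k) _ (Cx F)) => //.
  exact: isHom_blockdiag.
apply: (@general_polyfun _ _ _ _ _ _ (fun F : Mor B (cproj 2 l2) (tproj 2) =>
  discriminant (ymx (fun i j => F (inr i, j))))) => //.
- apply: polyfun_discriminant => c i j.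
  by apply: (eq_polyfun _ (@polyfun_py (cproj 2 l2) (tproj 2) (inr i, j) c)) => F; rewrite mxE.
- pose w : Mor B (cproj 2 l2) (tproj 2) := [ffun ij =>
    if ij.1 is inr i then mkB 0 0 0 0 (\row_c unitY c i ij.2) 0 else 0].
  exists w.
    by apply: corner_isHom => -[i|i] j; rewrite ffunE.
  by apply: discriminant_unitY => i j; rewrite ffunE.
Qed.

(** The 3 x 2 matrix with columns y and y' has rank at most 2, so some nonzero row vector is in its
    left kernel. *)
Lemma common_orthogonal (y y' : 'rV[k]_3) :
  exists v, [/\ v != 0, dot y v = 0 & dot y' v = 0].
Proof.
have dotE (u w : 'rV[k]_3) : dot u w = (w *m u^T) 0 0.
  by rewrite dotC mxE; apply: eq_bigr => i _; rewrite mxE.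
pose M := row_mx y^T y'^T.
have kerM : kermx M != 0.
  rewrite kermx_eq0 /row_free; apply: contraTneq (rank_leq_col M) => ->.
  by [].
have /rowV0Pn[v /sub_kermxP vM v0] := kerM.
exists v; move: vM; rewrite mul_mx_row => /eqP.
by rewrite row_mx_eq0 => /andP[/eqP vy /eqP vy']; rewrite !dotE vy vy' !mxE.
Qed.

Lemma pullm_comp (P Q R P' Q' R' : proj 3) (s : pidx P' -> pidx P)
    (t : pidx Q' -> pidx Q) t' (r : pidx R' -> pidx R) (G : Mor B Q R) (F : Mor B P Q) :
  cancel t t' -> cancel t' t ->
  pullm s r (Defs.comp G F) = Defs.comp (pullm t r G) (pullm s t F).
Proof.
move=> tt' t't; apply/ffunP => -[i j]; rewrite ffunE !compE /=.
rewrite (reindex t) /=; last by exists t' => x _; rewrite ?tt' ?t't.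
by apply: eq_bigr => l _; rewrite !ffunE.
Qed.

(* The y-components of the image of h f + g h' lie in the span of those of f
   and g, which is not all of k^3. *)
Lemma wildT_theta : wildT idem theta.
Proof.
move=> f g hf hg.
have [i|s [s' [ss' s's sl]]] := @label_bijection 3 (cproj 1 l2) (P1 theta).
  by rewrite card_label_cproj card_label_projOf ffunE; case: (labelP i).
have [i|t [t' [tt' t't tl]]] := @label_bijection 3 (tproj 1) (P0 theta).
  by rewrite card_label_tproj card_label_projOf ffunE; case: (labelP i).
have sl' : label_preserving s' by move=> i; rewrite -sl s's.
have tl' : label_preserving t' by move=> i; rewrite -tl t't.
have pb0 : pb (0 : B) = 0 by [].
have py0 : py (0 : B) = 0 by [].
have pymk b : py (mkB 0 b 0 0 0 0) = 0 :> 'rV[k]_3 by [].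
have pbmk x : pb (mkB 0 0 0 0 x 0) = 0 :> k by [].
pose y (F : HomT B theta) := py (pullm s t F (inr ord0, ord0)).
have [v [v0 fv gv]] := common_orthogonal (y f) (y g).
have [c vc] : exists c, v 0 c != 0.
  by apply/rV0Pn.
(* The y-component of w is a basis vector at a nonzero coordinate of v, so that the form takes the
   value [v 0 c] on w. *)
pose w : Mor B (cproj 1 l2) (tproj 1) := [ffun ij =>
  if ij.1 is inr _ then mkB 0 0 0 0 (delta_mx 0 c) 0 else 0].
have hw : isHom idem w by apply: corner_isHom => -[i|i] j; rewrite ffunE.
apply: (@dimHomShift_neq0 _ _ _ _ (@idemM k) theta f g (pullm s' t' w)
  (fun F => dot (y F) v)) => //.
- exact: isHom_pullm.
- by move=> a F G; rewrite /y pullm_linear !ffunE pyD dotD -dotZ.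
(* There are no nonzero maps from P to Q and the endomorphisms of Q are scalars, so h only rescales
   y(f). *)
- move=> h hh; have hh' := isHom_pullm tl tl hh.
  rewrite /y (pullm_comp _ _ _ _ tt' t't) compE sum_tproj1 pyD !pyM.
  rewrite (isHom_corner _ _ hh') [pullm t t h (inr _, inr _)](isHom_corner _ _ hh').
  transitivity (pb (pullm t t h (inr ord0, inr ord0)) * dot (y f) v);
    last by rewrite fv mulr0.
  by rewrite -dotZ; congr dot; rewrite /corner /= pb0 py0 pymk !simpB.
(* Likewise h, an endomorphism of R, only rescales y(g). *)
- move=> h hh; have hh' := isHom_pullm sl sl hh.
  have hg' := isHom_pullm sl tl hg.
  rewrite /y (pullm_comp _ _ _ _ ss' s's) compE big_ord1 pyM.
  transitivity (pc (pullm s s h (ord0, ord0)) * dot (y g) v);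
    last by rewrite gv mulr0.
  rewrite -dotZ; congr dot.
  by rewrite (isHom_corner _ _ hg') /corner /= pbmk !simpB.
- rewrite /y ffunE /= ffunE /= ss' tt' ffunE /=.
  rewrite /dot (bigD1 c) //= big1 => [|i ic]; last by rewrite mxE (negPf ic) mul0r.
  by rewrite mxE !eqxx mul1r addr0.
Qed.

End Example.

Lemma ind_theta (k : closedFieldType) x : ind (@idem k) theta x -> x = theta.
Proof.
case=> m [ths [dec [j <-]]].
by have [_ ->] := candec_indecT (indecT_theta k) dec.
Qed.

Lemma ind_theta2_point (k : closedFieldType) : ind (@idem k) theta2 point.
Proof. by exists 3, summands; split; [exact: candec_theta2 | exists l1]. Qed.

Lemma theta2_not_indecT (k : closedFieldType) : ~ indecT (@idem k) theta2.
Proof. by move=> /candec_indecT/(_ (candec_theta2 k))[]. Qed.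

Theorem theorem1p6 (k : closedFieldType) :
  exists (B : falgType k) (n : nat) (e : 'I_n -> B),
    completeIdems e /\
    exists th : K0 n,
      [/\ indecT e th, wildT e th,
          (forall R : realType,
             (forall v, cone (ind e th) v -> cone (R := R) (indN e th) v) /\
             exists v, cone (indN e th) v /\ ~ cone (R := R) (ind e th) v) &
          exists l : nat, (0 < l)%N /\ ~ indecT e [ffun i => th i *+ l]].
Proof.
exists (crossAlg k), 3, (@idem k); split; first exact: complete_idem.
exists theta; split; [exact: indecT_theta | exact: wildT_theta | |]; last first.
  by exists 2; split=> //; apply: theta2_not_indecT.
move=> R; split=> [v [s [hs vs]]|].
  exists s; split=> // x /hs[x0 hx]; split=> //; exists 1%N; split=> //.
  have -> // : [ffun i => theta i *+ 1] = theta.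
  by apply/ffunP => i; rewrite ffunE mulr1n.
exists (fun i => (point i)%:~R); split.
  exists [:: (1, point)]; split=> [x|i]; last by rewrite big_seq1 mul1r.
  rewrite inE => /eqP ->; split; first exact: ler01.
  by exists 2; split=> //; apply: ind_theta2_point.
case=> s [hs sv].
(* All generators equal [theta], so a combination is a multiple of it, with equal coordinates at
   [l0] and [l1]; those of [point] are 1 and 0. *)
have sumE i : \sum_(x <- s) x.1 * (x.2 i)%:~R = (\sum_(x <- s) x.1) * (theta i)%:~R.
  rewrite mulr_suml; apply: eq_big_seq => x /hs[_ /ind_theta ->] //.
have := sv l0; have := sv l1; rewrite !sumE !ffunE /= !mulr1 => <- /eqP.
by rewrite oner_eq0.
Qed.
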